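(* Let $L\subset\mathbb{R}P^3$ be a projective line and let $A\subset\mathbb{R}P^3$ be an $L$-convex-concave set. Then $A$ contains a projective line.
   Context: A subset $C$ of a real projective space $P$ is called convex if there is a hyperplane $H\subset P$ with $C\cap H=\emptyset$ such that $C$ is a convex subset of the affine space $P\setminus H$. Let $L\subset\mathbb{R}P^3$ be a projective line. A closed set $A\subset\mathbb{R}P^3$ is called $L$-convex-concave if: (1) $A\cap L=\emptyset$; (2) for every projective plane $N\subset\mathbb{R}P^3$ containing $L$, the intersection $A\cap N$ is convex; (3) for every point $T\in L$, the complement in $\mathbb{R}P^3/T\cong\mathbb{R}P^2$ of the image $\pi(A)$ under the projection $\pi:\mathbb{R}P^3\setminus\{T\}\to\mathbb{R}P^3/T$ from $T$ is an open convex set. (Here $\mathbb{R}P^3/T$ is the projective plane of all lines through $T$.) *)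

(* Defs.v *)
From HB Require Import structures.
From mathcomp Require Import all_boot all_order all_algebra.
From mathcomp Require Import all_classical all_reals all_analysis.

Set Implicit Arguments.
Unset Strict Implicit.
Unset Printing Implicit Defensive.

Import Order.TTheory GRing.Theory Num.Theory.
Import numFieldNormedType.Exports.
Local Open Scope classical_set_scope.
Local Open Scope ring_scope.

(* Projective spaces are handled through the lattice of linear subspaces of
   R^n.  For K <= W, [pspace K W] is the set of points of the projective space
   P(W / K), a point being a subspace of W that contains K as a hyperplane
   (i.e. the preimage in W of a line of W / K).  In particular
   - pspace 0 {:'rV[R]_4} is RP^3 itself, its points being the lines of R^4;
   - pspace 0 N is the projective subspace P(N) of RP^3, which is a projective
     line when \dim N = 2 and a projective plane when \dim N = 3;
   - if \dim T = 1, i.e. if T is a point of RP^3, then pspace T {:'rV[R]_4} is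
     RP^3 / T, the projective plane of all projective lines through T. *)
Definition pspace (R : realType) (n : nat) (K W : {vspace 'rV[R]_n}) :
    set {vspace 'rV[R]_n} :=
  [set U | [/\ (K <= U)%VS, (U <= W)%VS & \dim U = (\dim K).+1]].

(* The point of P(W / K) represented by a vector x of W \ K. *)
Definition pspace_pt (R : realType) (n : nat) (K : {vspace 'rV[R]_n})
    (x : 'rV[R]_n) : {vspace 'rV[R]_n} :=
  (K + <[x]>)%VS.

(* Quotient topology of W \ K, which has the topology induced by R^n.  In the
   library's [subspace D], whether a set is open only depends on its trace
   on D, so the values of pspace_pt outside W \ K are irrelevant. *)
Definition pspace_open (R : realType) (n : nat) (K W : {vspace 'rV[R]_n})
    (C : set {vspace 'rV[R]_n}) : Prop :=
  open (pspace_pt K @^-1` C :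
    set (subspace [set x : 'rV[R]_n | x \in W /\ x \notin K])).

Definition pspace_closed (R : realType) (n : nat) (K W : {vspace 'rV[R]_n})
    (C : set {vspace 'rV[R]_n}) : Prop :=
  pspace_open K W (pspace K W `\` C).

(* The hyperplanes of P(W / K) are the pspace K H for H as below. *)
Definition pspace_hyperplane (R : realType) (n : nat)
    (K W H : {vspace 'rV[R]_n}) : Prop :=
  [/\ (K <= H)%VS, (H <= W)%VS & \dim W = (\dim H).+1].

(* The affine structure on the complement of the hyperplane pspace K H comes
   from the translates w + H of H, w in W \ H: each maps onto the complement
   by pspace_pt K, with fibres the translates of K.  Two such translates differ
   by a homothety modulo H, so the choice of w does not matter. *)
Definition pspace_convex (R : realType) (n : nat) (K W : {vspace 'rV[R]_n})
    (C : set {vspace 'rV[R]_n}) : Prop :=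
  exists H : {vspace 'rV[R]_n},
    [/\ pspace_hyperplane K W H,
        C `&` pspace K H = set0 &
        exists w : 'rV[R]_n,
          [/\ w \in W, w \notin H &
              convex_set
                [set x : 'rV[R]_n | x - w \in H /\ C (pspace_pt K x)]]].

(* The projection from the point T sends the point p != T to the line T + p. *)
Definition L_convex_concave (R : realType) (L : {vspace 'rV[R]_4})
    (A : set {vspace 'rV[R]_4}) : Prop :=
  [/\ pspace_closed 0%VS fullv A,
      A `&` pspace 0%VS L = set0,
      (forall N : {vspace 'rV[R]_4}, \dim N = 3%N -> (L <= N)%VS ->
         pspace_convex 0%VS N (A `&` pspace 0%VS N)) &
      (forall T : {vspace 'rV[R]_4}, pspace 0%VS L T ->
         let coimage := pspace T fullv `\` [set (T + p)%VS | p in A] in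
         pspace_open T fullv coimage /\ pspace_convex T fullv coimage)].

(* Main.v *)
(* In coordinates R^4 = L + Q, let A_v (v in Q, v <> 0) be the set of all x in L
   such that x + v spans a point of A; it is a compact convex set and A_cv = cA_v.
   Let s(t, v) be the maximum on A_v of the functional of L defined by t.  It is
   sublinear in t.  Condition (3) says that it is finite and sublinear in v: the
   hyperplane disjoint from the complement of the projection from t is the graph
   of a linear h below s(t, .), and the complement is {s(t, .) - h < 1}.
   If a linear map B : Q -> L satisfies <t, Bv> <= s(t, v) for all t and v, then
   Bv lies in A_v by separation, so that the graph of B is a line contained in A.

   The existence of B reduces, by the Hahn-Banach theorem for the function
   inf (sum s(t_i, v_i)) of sum t_i (x) v_i, to the inequality
   sum s(t_i, v_i) >= 0 whenever sum t_i (x) v_i = 0.  This is proved by induction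
   on the number of terms.  Terms with a common factor are merged.  If there are
   at least six terms, Caratheodory's argument removes one.  Otherwise four of the
   terms form a pinwheel: some rank one y returns to a multiple of itself, y ->
   y + c_1 P_1 -> ... -> y + c_1 P_1 + ... + c_4 P_4 = c y, along rank one matrices
   and with c_i >= 0, each step joining matrices with a common factor.  Summing the
   sublinearity inequalities along the walk yields s((c - 1) y) <= sum c_i s(P_i),
   hence again a relation with fewer terms.  For four terms the pinwheel exists by
   Cramer's rule, and for five it is found by enumerating sign patterns. *)

Require Import Defs.
From HB Require Import structures.
From mathcomp Require Import all_boot all_order all_algebra.
From mathcomp Require Import all_classical all_reals all_analysis.
From mathcomp Require Import ring lra zify.

Set Implicit Arguments.
Unset Strict Implicit.
Unset Printing Implicit Defensive.

Import Order.TTheory GRing.Theory Num.Theory.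
Import numFieldNormedType.Exports.
Local Open Scope ring_scope.

(** * Determinants of pairs of plane vectors *)

(* The functionals on R^2 are the maps [det2 t]; their kernels are spanned by
   [t], which makes [det2 t] the projection of L from its point [t]. *)
Definition det2 (R : pzRingType) (u v : 'rV[R]_2) : R :=
  u 0 0 * v 0 1 - u 0 1 * v 0 0.

Lemma rV2P (T : Type) (u v : 'rV[T]_2) : u 0 0 = v 0 0 -> u 0 1 = v 0 1 -> u = v.
Proof.
move=> h0 h1; apply/rowP => i.
by have /orP[/eqP->|/eqP->] : (i == 0) || (i == 1) by case: i => [[|[]]].
Qed.

Section Det2.
Variable R : comPzRingType.
Implicit Types u v w x : 'rV[R]_2.

Lemma det2C u v : det2 u v = - det2 v u.
Proof. by rewrite /det2; ring. Qed.

Lemma det2vv u : det2 u u = 0.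
Proof. by rewrite /det2; ring. Qed.

Lemma det2Dr u v w : det2 u (v + w) = det2 u v + det2 u w.
Proof. by rewrite /det2 !mxE; ring. Qed.

Lemma det2Dl u v w : det2 (u + v) w = det2 u w + det2 v w.
Proof. by rewrite /det2 !mxE; ring. Qed.

Lemma det2Zr c u v : det2 u (c *: v) = c * det2 u v.
Proof. by rewrite /det2 !mxE; ring. Qed.

Lemma det2Zl c u v : det2 (c *: u) v = c * det2 u v.
Proof. by rewrite /det2 !mxE; ring. Qed.

Lemma det2Nl u v : det2 (- u) v = - det2 u v.
Proof. by rewrite /det2 !mxE; ring. Qed.

Lemma det2Nr u v : det2 u (- v) = - det2 u v.
Proof. by rewrite /det2 !mxE; ring. Qed.

Lemma det2_cramer u v w : det2 u v *: w = det2 w v *: u + det2 u w *: v.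
Proof. by apply: rV2P; rewrite /det2 !mxE; ring. Qed.

Lemma det2_plucker u v w x :
  det2 u v * det2 w x - det2 u w * det2 v x + det2 u x * det2 v w = 0.
Proof. by rewrite /det2; ring. Qed.

(** The bilinear form [det2 a] (x) [det2 b] is applied to the relation. With [a] among the [l i] and
    [b] among the [v i] it kills chosen terms. *)
Lemma tens_eq0_det2 (I : finType) (l v : I -> 'rV[R]_2) (a b : 'rV[R]_2) :
  \sum_i (l i)^T *m v i = 0 -> \sum_i det2 a (l i) * det2 b (v i) = 0.
Proof.
move=> /matrixP h.
have {}h j k : \sum_i l i 0 j * v i 0 k = 0.
  have := h j k; rewrite summxE mxE; apply: etrans.
  by apply: eq_bigr => i _; rewrite !mxE big_ord1 !mxE.
have -> : \sum_i det2 a (l i) * det2 b (v i) =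
   a 0 0 * b 0 0 * (\sum_i l i 0 1 * v i 0 1) -
   a 0 0 * b 0 1 * (\sum_i l i 0 1 * v i 0 0) -
   a 0 1 * b 0 0 * (\sum_i l i 0 0 * v i 0 1) +
   a 0 1 * b 0 1 * (\sum_i l i 0 0 * v i 0 0).
  rewrite !mulr_sumr -!sumrB -big_split; apply: eq_bigr => i _.
  by rewrite /det2 /=; ring.
by rewrite !h; ring.
Qed.

End Det2.

Section Det2Field.
Variable F : fieldType.
Implicit Types u v w : 'rV[F]_2.

Lemma det2_solve u v w : det2 u v != 0 ->
  w = (det2 w v / det2 u v) *: u + (det2 u w / det2 u v) *: v.
Proof.
move=> uv0; apply: (scalerI uv0).
by rewrite scalerDr !scalerA !(mulrC _ (_ / _)) !divfK// -det2_cramer.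
Qed.

Lemma det2_eq0 u v : u != 0 -> det2 u v = 0 -> exists c, v = c *: u.
Proof.
move=> u0 uv0; have [u00|u00] := eqVneq (u 0 0) 0.
  have u01 : u 0 1 != 0.
    by apply: contra_neq u0 => u01; apply: rV2P; rewrite !mxE.
  exists (v 0 1 / u 0 1); apply: rV2P; rewrite !mxE; last by field.
  move: uv0; rewrite /det2 u00 mul0r sub0r mulr0 => /eqP.
  by rewrite oppr_eq0 mulf_eq0 (negbTE u01) => /eqP.
exists (v 0 0 / u 0 0); apply: rV2P; rewrite !mxE; first by field.
apply: (mulfI u00); move/subr0_eq: uv0 => ->.
by rewrite mulrA mulrC mulrA; field.
Qed.

End Det2Field.

(** A rotation by a right angle, so that [det2 (perp u)] is the Euclidean inner product with [u]. *)
Definition perp (R : pzRingType) (u : 'rV[R]_2) : 'rV[R]_2 :=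
  \row_(j < 2) (if j == 0 then u 0 1 else - u 0 0).

Lemma det2_perp (R : comPzRingType) (u w : 'rV[R]_2) :
  det2 (perp u) w = u 0 0 * w 0 0 + u 0 1 * w 0 1.
Proof. by rewrite /det2 !mxE /=; ring. Qed.

Lemma det2_perp_gt0 (R : realDomainType) (u : 'rV[R]_2) : u != 0 -> 0 < det2 (perp u) u.
Proof.
move=> u0; rewrite det2_perp -!expr2 lt_neqAle addr_ge0 ?sqr_ge0// andbT eq_sym.
rewrite paddr_eq0 ?sqr_ge0// !sqrf_eq0; apply: contra u0 => /andP[/eqP u00 /eqP u01].
by apply/eqP/rV2P; rewrite mxE.
Qed.

(** * Bisublinear functions and rank one matrices *)

(* By [bisubNN] and homogeneity, [s l v] only depends on the rank one matrix
   [l^T *m v]. *)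
Record bisublinear (R : realFieldType) (s : 'rV[R]_2 -> 'rV[R]_2 -> R) : Prop := {
  bisubDl : forall l l' v, s (l + l') v <= s l v + s l' v;
  bisubDr : forall l v v', s l (v + v') <= s l v + s l v';
  bisubZl : forall c l v, 0 <= c -> s (c *: l) v = c * s l v;
  bisubZr : forall c l v, 0 <= c -> s l (c *: v) = c * s l v;
  bisubNN : forall l v, s (- l) (- v) = s l v }.

Section Bisublinear.
Variables (R : realFieldType) (s : 'rV[R]_2 -> 'rV[R]_2 -> R).
Hypothesis sb : bisublinear s.
Implicit Types l v : 'rV[R]_2.

Lemma bisub0l v : s 0 v = 0.
Proof. by rewrite -(scale0r 0) (bisubZl sb)// mul0r. Qed.

Lemma bisub0r l : s l 0 = 0.
Proof. by rewrite -(scale0r 0) (bisubZr sb)// mul0r. Qed.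

Lemma bisubZ c l v : s (c *: l) v = s l (c *: v).
Proof.
have [c0|/ltW c0] := leP 0 c; first by rewrite (bisubZl sb)// (bisubZr sb).
rewrite -(bisubNN sb) -scaleNr (bisubZl sb) ?oppr_ge0//.
by rewrite -[c *: v]opprK -scaleNr -scalerN (bisubZr sb) ?oppr_ge0.
Qed.

(* The rank one matrices w1 *: l4^T *m v1, w2 *: l2^T *m v1, w3 *: l2^T *m v3,
   w4 *: l4^T *m v3 and w5 *: l4^T *m v1 form a walk, closed up to scaling; each
   step stays in a linear plane of rank one matrices, where [s] is sublinear.
   When |w5| < |w1| the walk is reversed and its signs are changed. *)
Lemma bisub_walk t1 t2 t3 t4 w1 w2 w3 w4 w5 l1 l2 l3 l4 v1 v2 v3 v4 :
    0 <= t1 -> 0 <= t2 -> 0 <= t3 -> 0 <= t4 -> 0 <= w1 * w5 ->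
    w1 *: l4 + t1 *: l1 = w2 *: l2 -> w2 *: v1 + t2 *: v2 = w3 *: v3 ->
    w3 *: l2 + t3 *: l3 = w4 *: l4 -> w4 *: v3 + t4 *: v4 = w5 *: v1 ->
  t1 *: (l1^T *m v1) + t2 *: (l2^T *m v2) + t3 *: (l3^T *m v3) +
    t4 *: (l4^T *m v4) = (w5 - w1) *: (l4^T *m v1) /\
  s ((w5 - w1) *: l4) v1 <=
    t1 * s l1 v1 + t2 * s l2 v2 + t3 * s l3 v3 + t4 * s l4 v4.
Proof.
move=> t1_ge0 t2_ge0 t3_ge0 t4_ge0 w15 e1 e2 e3 e4.
have f1 : t1 *: l1 = w2 *: l2 - w1 *: l4 by rewrite -e1 addrC addKr.
have f2 : t2 *: v2 = w3 *: v3 - w2 *: v1 by rewrite -e2 addrC addKr.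
have f3 : t3 *: l3 = w4 *: l4 - w3 *: l2 by rewrite -e3 addrC addKr.
have f4 : t4 *: v4 = w5 *: v1 - w4 *: v3 by rewrite -e4 addrC addKr.
split.
  have scaleT t (l v : 'rV[R]_2) : t *: (l^T *m v) = (t *: l)^T *m v.
    by rewrite scalemxAl linearZ.
  rewrite (scaleT t1) (scaleT t3) f1 f3 ![_ *: (_ *m _)]scalemxAr f2 f4.
  by apply/matrixP => i j; rewrite !mxE !big_ord1 !mxE; ring.
have step l l' l'' v w w' t : 0 <= t -> w *: l + t *: l' = w' *: l'' ->
    s (w' *: l'') v <= s (w *: l) v + t * s l' v.
  by move=> t_ge0 <-; rewrite -(bisubZl sb)//; exact: bisubDl.
have stepr l v v' v'' w w' t : 0 <= t -> w *: v + t *: v' = w' *: v'' ->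
    s (w' *: l) v'' <= s (w *: l) v + t * s l v'.
  by move=> t_ge0 e; rewrite !bisubZ -e -(bisubZr sb)//; exact: bisubDr.
have opp (l l' l'' : 'rV[R]_2) w w' t : w *: l + t *: l' = w' *: l'' ->
    (- w') *: l'' + t *: l' = (- w) *: l.
  by move=> e; rewrite !scaleNr -e opprD addrNK.
have fwd : s (w5 *: l4) v1 <= s (w1 *: l4) v1 +
    (t1 * s l1 v1 + t2 * s l2 v2 + t3 * s l3 v3 + t4 * s l4 v4).
  have := step _ _ _ v1 _ _ _ t1_ge0 e1; have := stepr l2 _ _ _ _ _ _ t2_ge0 e2.
  have := step _ _ _ v3 _ _ _ t3_ge0 e3; have := stepr l4 _ _ _ _ _ _ t4_ge0 e4.
  by lra.
have bwd : s ((- w1) *: l4) v1 <= s ((- w5) *: l4) v1 +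
    (t1 * s l1 v1 + t2 * s l2 v2 + t3 * s l3 v3 + t4 * s l4 v4).
  have := step _ _ _ v1 _ _ _ t1_ge0 (opp _ _ _ _ _ _ e1).
  have := stepr l2 _ _ _ _ _ _ t2_ge0 (opp _ _ _ _ _ _ e2).
  have := step _ _ _ v3 _ _ _ t3_ge0 (opp _ _ _ _ _ _ e3).
  have := stepr l4 _ _ _ _ _ _ t4_ge0 (opp _ _ _ _ _ _ e4).
  by lra.
move: fwd bwd; set S := _ + _ + _ + _; move: S => S.
have pos c : 0 <= c -> s (c *: l4) v1 = c * s l4 v1 by exact: (bisubZl sb).
have neg c : c <= 0 -> s (c *: l4) v1 = - c * s (- l4) v1.
  by move=> c0; rewrite -(bisubZl sb) ?oppr_ge0// scalerN scaleNr opprK.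
(* Both ends of the walk lie on one ray, where [s] is linear, and can be subtracted: [fwd] serves
   when [w5 - w1] has their sign, [bwd] otherwise. *)
have [[w1_ge0 w5_ge0]|[w1_le0 w5_le0]] : 0 <= w1 /\ 0 <= w5 \/ w1 <= 0 /\ w5 <= 0.
- case: (leP 0 w1) w15 => [w1_ge0|w1_lt0].
    case: (leP 0 w5) => [|w5_lt0]; first by left.
    by rewrite nmulr_lge0// (ltW w5_lt0); right.
  by rewrite nmulr_rge0// (ltW w1_lt0); right.
- rewrite (pos w1)// (pos w5)// (neg (- w1)) ?oppr_le0// (neg (- w5)) ?oppr_le0//.
  by case: (leP w1 w5) => [?|/ltW ?]; [rewrite pos|rewrite neg]; lra.
rewrite (neg w1)// (neg w5)// (pos (- w1)) ?oppr_ge0// (pos (- w5)) ?oppr_ge0//.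
by case: (leP w1 w5) => [?|/ltW ?]; [rewrite pos|rewrite neg]; lra.
Qed.

(* The signs of the determinants are those for which the coefficients of the
   walk of [bisub_walk], given by Cramer's rule, are admissible. *)
Lemma bisub_pinwheel l1 l2 l3 l4 v1 v2 v3 v4 :
    let sigma := det2 l2 l4 * det2 v1 v3 in
    sigma * (det2 l1 l2 * det2 v3 v4) < 0 -> sigma * (det2 l3 l4 * det2 v1 v2) < 0 ->
    sigma * (det2 l2 l3 * det2 v1 v4) < 0 -> sigma * (det2 l1 l4 * det2 v2 v3) < 0 ->
  exists t1 t2 t3 t4 g, [/\ 0 < t1, 0 <= t2, 0 <= t3 & 0 <= t4] /\
    (t1 *: (l1^T *m v1) + t2 *: (l2^T *m v2) + t3 *: (l3^T *m v3) +
      t4 *: (l4^T *m v4) = g *: (l4^T *m v1) /\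
    s (g *: l4) v1 <= t1 * s l1 v1 + t2 * s l2 v2 + t3 * s l3 v3 + t4 * s l4 v4).
Proof.
have [->|l24] := eqVneq (det2 l2 l4) 0; first by rewrite /= !mul0r ltxx.
have [->|v13] := eqVneq (det2 v1 v3) 0; first by rewrite /= mulr0 !mul0r ltxx.
have := det2_solve l1 l24; have := det2_solve v2 v13.
have := det2_solve l3 l24; have := det2_solve v4 v13.
rewrite (det2C l2 l1) (det2C v4 v3) /=.
move: l24 v13.
move: (det2 l2 l4) (det2 v1 v3) => D E D0 E0.
move: (det2 l1 l2) (det2 v3 v4) (det2 l3 l4) (det2 v1 v2) => a a' b b'.
move: (det2 l2 l3) (det2 v1 v4) (det2 l1 l4) (det2 v2 v3) => c c' d d'.
move=> ev4 el3 ev2 el1 ha hb hc hd.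
have d0 : d != 0 by apply: contraTneq hd => ->; rewrite mul0r mulr0 ltxx.
have d'0 : d' != 0 by apply: contraTneq hd => ->; rewrite !mulr0 ltxx.
have b0 : b != 0 by apply: contraTneq hb => ->; rewrite mul0r mulr0 ltxx.
have c'0 : c' != 0 by apply: contraTneq hc => ->; rewrite !mulr0 ltxx.
(* The walk starts with [t1 = 1]; each later [t] makes its step cancel the factor that has to
   disappear. The last witness is [w5 - w1]. *)
exists 1, (- (d * E) / (D * d')), (d * b' / (d' * b)).
exists (- (d * b' * c * E) / (d' * b * D * c')).
exists (d * b' * c * a' / (d' * b * D * c') - a / D).
have ndd : 0 <= - (D * E * (d * d')) by rewrite oppr_ge0 ltW.
have nbb : 0 <= - (D * E * (b * b')) by rewrite oppr_ge0 ltW.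
have ncc : 0 <= - (D * E * (c * c')) by rewrite oppr_ge0 ltW.
have naa : 0 <= - (D * E * (a * a')) by rewrite oppr_ge0 ltW.
have t2_ge0 : 0 <= - (d * E) / (D * d').
  rewrite (_ : _ / _ = - (D * E * (d * d')) / (D * d') ^+ 2).
    by rewrite divr_ge0// sqr_ge0.
  by field; rewrite ?D0 ?E0 ?d'0 ?b0 ?c'0.
have t3_ge0 : 0 <= d * b' / (d' * b).
  rewrite (_ : _ / _ = (- (D * E * (d * d')) * - (D * E * (b * b'))) / (D * E * d' * b) ^+ 2).
    by rewrite divr_ge0 ?sqr_ge0 ?mulr_ge0.
  by field; rewrite ?D0 ?E0 ?d'0 ?b0 ?c'0.
have t4_ge0 : 0 <= - (d * b' * c * E) / (d' * b * D * c').
  rewrite (_ : _ / _ = (- (D * E * (d * d')) * - (D * E * (b * b')) *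
     - (D * E * (c * c'))) / (D ^+ 2 * E * d' * b * c') ^+ 2).
    by rewrite divr_ge0 ?sqr_ge0 ?mulr_ge0.
  by field; rewrite ?D0 ?E0 ?d'0 ?b0 ?c'0.
split=> //.
apply: (@bisub_walk _ _ _ _ (a / D) (d / D) (- (d * b') / (D * d'))
  (d * b' * c / (d' * b * D))) => //.
- rewrite (_ : _ * _ = (- (D * E * (d * d')) * - (D * E * (b * b')) *
     - (D * E * (c * c')) * - (D * E * (a * a'))) / (D ^+ 3 * E ^+ 2 * d' * b * c') ^+ 2).
    by rewrite divr_ge0 ?sqr_ge0 ?mulr_ge0.
  by field; rewrite ?D0 ?E0 ?d'0 ?b0 ?c'0.
- by rewrite el1; apply/rowP => i; rewrite !mxE; field; rewrite ?D0 ?E0 ?d'0 ?b0 ?c'0.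
- by rewrite ev2; apply/rowP => i; rewrite !mxE; field; rewrite ?D0 ?E0 ?d'0 ?b0 ?c'0.
- by rewrite el3; apply/rowP => i; rewrite !mxE; field; rewrite ?D0 ?E0 ?d'0 ?b0 ?c'0.
- by rewrite ev4; apply/rowP => i; rewrite !mxE; field; rewrite ?D0 ?E0 ?d'0 ?b0 ?c'0.
Qed.

End Bisublinear.

(** * Sign patterns of five pairs of plane vectors *)

(** Tables hold the signs of the determinants of five vectors, [true] standing for a positive
    one. *)
Definition entry (t : seq (seq bool)) i j := nth false (nth [::] t i) j.

Fixpoint bits n : seq (seq bool) :=
  if n is n'.+1 then [seq b :: s | b <- [:: true; false], s <- bits n'] else [:: [::]].

Definition antisym_table (b : seq bool) : seq (seq bool) :=
  if b is [:: b01; b02; b03; b04; b12; b13; b14; b23; b24; b34] then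
    [:: [:: false; b01; b02; b03; b04]; [:: ~~ b01; false; b12; b13; b14];
        [:: ~~ b02; ~~ b12; false; b23; b24]; [:: ~~ b03; ~~ b13; ~~ b23; false; b34];
        [:: ~~ b04; ~~ b14; ~~ b24; ~~ b34; false]]
  else [::].

(* Signs compatible with the Pluecker relation ab.cd - ac.bd + ad.bc = 0. *)
Definition plucker_signs (x : nat -> nat -> bool) a b c d :=
  ((x a b == x c d) != (x a c != x b d)) || ((x a d == x b c) != (x a c != x b d)).

Definition plucker_table (x : nat -> nat -> bool) :=
  [&& plucker_signs x 0 1 2 3, plucker_signs x 0 1 2 4, plucker_signs x 0 1 3 4,
      plucker_signs x 0 2 3 4 & plucker_signs x 1 2 3 4].

(* Unlike [all] and [has], these stop at the first decisive index when they are
   evaluated by value, as in [pinwheel_check]. *)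
Fixpoint all_lt (p : pred nat) n :=
  if n is n'.+1 then if p n' then all_lt p n' else false else true.

Definition has_lt (p : pred nat) n := ~~ all_lt (fun i => ~~ p i) n.

(* The terms x k i * y j i of a vanishing sum have both signs. *)
Definition mixed_signs (x y : nat -> nat -> bool) :=
  all_lt (fun j => all_lt (fun k =>
    let p b := has_lt (fun i => if (i == j) || (i == k) then false
                                else (x k i == y j i) == b) 5 in
    if p true then p false else false) 5) 5.

(* The sign conditions of [bisub_pinwheel]. *)
Definition pinwheel (x y : nat -> nat -> bool) a b c d :=
  let sigma := x b d == y a c in
  if (x a b == y c d) == sigma then false else
  if (x c d == y a b) == sigma then false else
  if (x b c == y a d) == sigma then false else
  (x a d == y b c) != sigma.

Definition has_pinwheel (x y : nat -> nat -> bool) :=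
  has_lt (fun a => has_lt (fun b => if a == b then false else
  has_lt (fun c => if (a == c) || (b == c) then false else
  has_lt (fun d => if [|| a == d, b == d | c == d] then false else
    pinwheel x y a b c d) 5) 5) 5) 5.

(* The four initial [true] of [u] are no loss of generality: a pair may be
   replaced with its opposite, see [rel_five]. *)
Lemma pinwheel_check :
  all (fun t => all (fun u => if mixed_signs (entry t) (entry u) then
    has_pinwheel (entry t) (entry u) else true)
    [seq u <- [seq antisym_table (nseq 4 true ++ b) | b <- bits 6] | plucker_table (entry u)])
    [seq t <- [seq antisym_table b | b <- bits 10] | plucker_table (entry t)].
Proof. by vm_compute. Qed.

Lemma all_ltP (p : pred nat) n : reflect (forall i, (i < n)%N -> p i) (all_lt p n).
Proof.
elim: n => [|n IH] /=; first by apply: ReflectT.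
case: ifPn => pn; last by apply: ReflectF => /(_ n (ltnSn n)); apply/negP.
apply: (iffP IH) => h i; last by move=> /ltnW; apply: h.
by rewrite ltnS leq_eqVlt => /orP[/eqP->//|]; apply: h.
Qed.

Lemma has_ltP (p : pred nat) n : reflect (exists2 i, (i < n)%N & p i) (has_lt p n).
Proof.
elim: n => [|n IH]; rewrite /has_lt /=; first by apply: ReflectF => -[].
case pn: (p n); first by apply: ReflectT; exists n.
apply: (iffP IH) => -[i ltin pi]; exists i => //; first exact: ltnW.
by move: ltin pi; rewrite ltnS leq_eqVlt => /orP[/eqP->|//]; rewrite pn.
Qed.

Lemma bitsP b : b \in bits (size b).
Proof.
elim: b => // b s IH /=; rewrite mem_cat; case: b; first by rewrite map_f.
by rewrite cats0 map_f// orbT.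
Qed.

(** The tables [f x] and [f y] agree with [x] and [y] off the diagonal and are among those
    enumerated in [pinwheel_check], thanks to the normalization of [y 0 i]. *)
Lemma five_pinwheel (x y : nat -> nat -> bool) :
    (forall i j, (i < 5)%N -> (j < 5)%N -> i != j -> x j i = ~~ x i j) ->
    (forall i j, (i < 5)%N -> (j < 5)%N -> i != j -> y j i = ~~ y i j) ->
    (forall i, (0 < i < 5)%N -> y 0 i) ->
    (forall a b c d, (d < 5)%N -> (a < b < c)%N -> (c < d)%N -> plucker_signs x a b c d) ->
    (forall a b c d, (d < 5)%N -> (a < b < c)%N -> (c < d)%N -> plucker_signs y a b c d) ->
    (forall j k e, (j < 5)%N -> (k < 5)%N -> exists i,
      [/\ (i < 5)%N, i != j, i != k & (x k i == y j i) = e]) ->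
  exists a b c d, [/\ (a < 5)%N, (b < 5)%N, (c < 5)%N & (d < 5)%N] /\
    uniq [:: a; b; c; d] /\ pinwheel x y a b c d.
Proof.
move=> xA yA y0 px py mix.
pose f (z : nat -> nat -> bool) := antisym_table
  [:: z 0 1; z 0 2; z 0 3; z 0 4; z 1 2; z 1 3; z 1 4; z 2 3; z 2 4; z 3 4].
have fE z i j : (forall i j, (i < 5)%N -> (j < 5)%N -> i != j -> z j i = ~~ z i j) ->
    (i < 5)%N -> (j < 5)%N -> i != j -> entry (f z) i j = z i j.
  move=> zA i5 j5 ij; move: i5 j5 ij (zA j i).
  do 5?[case: i => [|i]]; do 5?[case: j => [|j]] => // _ _ _;
    by rewrite /entry /= => ->.
have fxE := fE x _ _ xA; have fyE := fE y _ _ yA.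
have chk z :
    (forall a b c d, (d < 5)%N -> (a < b < c)%N -> (c < d)%N -> plucker_signs z a b c d) ->
   plucker_table (entry (f z)).
  by move=> pz; rewrite /plucker_table; apply/and5P; split; apply: pz.
have tP : f x \in [seq t <- [seq antisym_table b | b <- bits 10] | plucker_table (entry t)].
  rewrite mem_filter chk// andTb; apply/mapP.
  exists [:: x 0 1; x 0 2; x 0 3; x 0 4; x 1 2; x 1 3; x 1 4; x 2 3; x 2 4; x 3 4] => //.
  exact: bitsP.
have uP : f y \in [seq u <- [seq antisym_table (nseq 4 true ++ b) | b <- bits 6] |
    plucker_table (entry u)].
  rewrite mem_filter chk// andTb; apply/mapP.
  exists [:: y 1 2; y 1 3; y 1 4; y 2 3; y 2 4; y 3 4]; first exact: bitsP.
  by rewrite /f !y0.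
have := allP (allP pinwheel_check _ tP) _ uP; rewrite ifT; last first.
  apply/all_ltP => j j5; apply/all_ltP => k k5 /=.
  have mixE e : has_lt (fun i => if (i == j) || (i == k) then false
      else (entry (f x) k i == entry (f y) j i) == e) 5.
    have [i [i5 ij ik h]] := mix j k e j5 k5; apply/has_ltP; exists i => //.
    by rewrite (negbTE ij) (negbTE ik) /= fxE ?fyE// 1?eq_sym// h.
  by rewrite !mixE.
move=> /has_ltP[a a5] /has_ltP[b b5]; case: eqVneq => // ab.
move=> /has_ltP[c c5]; case: ifPn => //; rewrite negb_or => /andP[ac bc].
move=> /has_ltP[d d5]; case: ifPn => //; rewrite !negb_or => /and3P[ad bd cd].
rewrite /pinwheel !fxE// !fyE// => h; exists a, b, c, d; split=> //; split=> //.
by rewrite /= !inE !negb_or ab ac ad bc bd cd.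
Qed.

Lemma mulr_gt0_eqb (R : realFieldType) (x y : R) : x != 0 -> y != 0 ->
  (0 < x * y) = ((0 < x) == (0 < y)).
Proof.
move=> x0 y0; case: (ltgtP 0 x) x0 => // x_sgn _.
  by rewrite pmulr_rgt0//; case: (0 < y).
by rewrite nmulr_rgt0//; case: (ltgtP 0 y) y0.
Qed.

Lemma gt0_det2C (R : realFieldType) (u v : 'rV[R]_2) : det2 u v != 0 ->
  (0 < det2 v u) = ~~ (0 < det2 u v).
Proof. by move=> uv0; rewrite (det2C v) oppr_gt0; case: ltgtP uv0. Qed.

Lemma plucker_signs_det2 (R : realFieldType) (u : nat -> 'rV[R]_2) a b c d :
    det2 (u a) (u b) != 0 -> det2 (u c) (u d) != 0 -> det2 (u a) (u c) != 0 ->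
    det2 (u b) (u d) != 0 -> det2 (u a) (u d) != 0 -> det2 (u b) (u c) != 0 ->
  plucker_signs (fun i j => 0 < det2 (u i) (u j)) a b c d.
Proof.
move=> ab cd ac bd ad bc; have := det2_plucker (u a) (u b) (u c) (u d).
rewrite /plucker_signs -!mulr_gt0_eqb//.
move: (mulf_neq0 ab cd) (mulf_neq0 ac bd) (mulf_neq0 ad bc).
move: (det2 _ _ * _) (det2 (u a) (u c) * _) (det2 (u a) (u d) * _) => x y z.
by case: (ltgtP 0 x) => // ? _; case: (ltgtP 0 y) => // ? _;
  case: (ltgtP 0 z) => // ? _ ?; lra.
Qed.

Lemma nmulr_lt0_eqb (R : realFieldType) (x y z t : R) :
  x != 0 -> y != 0 -> z != 0 -> t != 0 ->
  ((0 < z) == (0 < t)) != ((0 < x) == (0 < y)) -> (x * y) * (z * t) < 0.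
Proof.
move=> x0 y0 z0 t0; rewrite -(mulr_gt0_eqb x0 y0) -(mulr_gt0_eqb z0 t0).
move: (mulf_neq0 x0 y0) (mulf_neq0 z0 t0) => {x0 y0 z0 t0}.
move: (x * y) (z * t) => {x y z t} x y.
case: (ltgtP 0 x) => // x_sgn _; case: (ltgtP 0 y) => // y_sgn _ // _.
  by rewrite pmulr_rlt0.
by rewrite nmulr_rlt0.
Qed.

(** * Linear relations between rank one matrices *)

Section Relations.
Variables (R : realFieldType) (I : finType).
Implicit Types (s : 'rV[R]_2 -> 'rV[R]_2 -> R) (l v : I -> 'rV[R]_2).

Definition tsupp l v := [set i | (l i != 0) && (v i != 0)].

(** The induction hypothesis of [rel_bisublinear], on the number of nonzero terms. *)
Definition rel_nneg s m := forall l v, (#|tsupp l v| < m)%N ->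
  \sum_i (l i)^T *m v i = 0 -> 0 <= \sum_i s (l i) (v i).

(** Exchanging the factors transposes a relation, so that arguments about the [v i] also serve for
    the [l i]. *)
Definition flip s := fun a b => s b a.

Lemma tsuppC l v : tsupp l v = tsupp v l.
Proof. by apply/setP => i; rewrite !inE andbC. Qed.

Lemma bisublinear_flip s : bisublinear s -> bisublinear (flip s).
Proof. by case=> *; split => *; rewrite /flip; auto. Qed.

Lemma sum_tens_flip l v (d : I -> R) :
  \sum_i d i *: ((v i)^T *m l i) = (\sum_i d i *: ((l i)^T *m v i))^T.
Proof.
by rewrite linear_sum; apply: eq_bigr => i _; rewrite linearZ /= trmx_mul trmxK.
Qed.

Lemma sum_tens_flip0 l v :
  \sum_i (l i)^T *m v i = 0 -> \sum_i (v i)^T *m l i = 0.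
Proof.
move=> /(congr1 trmx); rewrite trmx0 linear_sum /= => /(etrans _); apply.
by apply: eq_bigr => i _; rewrite trmx_mul trmxK.
Qed.

Lemma rel_nneg_flip s m : rel_nneg s m -> rel_nneg (flip s) m.
Proof.
by move=> h l v hm /sum_tens_flip0; apply: h; rewrite tsuppC.
Qed.

(** Subtracting the combination [d] leaves nonnegative coefficients [1 - d k] on the support and
    kills the term [i0]; the rank one remainder joins the term [p], whose right factor it shares.
    The cost does not increase. *)
Lemma rel_shrink s m l v d p i0 a : bisublinear s -> rel_nneg s m ->
    (#|tsupp l v| <= m)%N -> \sum_i (l i)^T *m v i = 0 ->
    p \in tsupp l v -> i0 \in tsupp l v -> p != i0 ->
    (forall k, k \in tsupp l v -> d k <= 1) -> d i0 = 1 ->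
    \sum_k d k *: ((l k)^T *m v k) = a^T *m v p ->
    s a (v p) <= \sum_k d k * s (l k) (v k) ->
  0 <= \sum_i s (l i) (v i).
Proof.
move=> sb IH lm h0 pS iS pi0 d_le1 di0 hd hs.
pose l' k := (1 - d k) *: l k + (if k == p then a else 0).
have sE k : s ((1 - d k) *: l k) (v k) = (1 - d k) * s (l k) (v k).
  have [kS|] := boolP (k \in tsupp l v); first by rewrite bisubZl// subr_ge0 d_le1.
  rewrite inE negb_and !negbK => /orP[/eqP->|/eqP->].
    by rewrite scaler0 (bisub0l sb) mulr0.
  by rewrite !(bisub0r sb) mulr0.
have /IH : (#|tsupp l' v| < m)%N.
  apply: leq_trans lm; apply/proper_card/properP; split.
    apply/fintype.subsetP => k; rewrite !inE /l' => /andP[+ ->]; rewrite andbT.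
    apply: contra_neq => lk0; move: pS; rewrite inE.
    have [<-|_ _] := eqVneq k p; first by rewrite lk0 eqxx.
    by rewrite lk0 scaler0 addr0.
  exists i0 => //; rewrite inE /l' di0 subrr scale0r add0r ifN ?eqxx//.
  by rewrite eq_sym.
have delta (V : nmodType) (x : V) : \sum_k (if k == p then x else 0) = x.
  by rewrite -big_mkcond big_pred1_eq.
have -> : \sum_i (l' i)^T *m v i = 0.
  under eq_bigr => k _.
    rewrite /l' linearD /= mulmxDl linearZ /= -scalemxAl scalerBl scale1r.
    rewrite (_ : (if _ then _ else _)^T *m v k = if k == p then a^T *m v p else 0); last first.
      by case: eqP => [->//|_]; rewrite trmx0 mul0mx.
    over.
  by rewrite big_split sumrB /= h0 hd delta sub0r addNr.
move=> /(_ erefl) /le_trans; apply.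
apply: (@le_trans _ _ (\sum_k ((1 - d k) * s (l k) (v k) +
   (if k == p then s a (v p) else 0)))).
  apply: ler_sum => k _; rewrite -sE; apply: le_trans (bisubDl sb _ _ _) _.
  by case: eqP => [->//|_]; rewrite (bisub0l sb).
rewrite big_split /= delta; under eq_bigr do rewrite mulrBl mul1r.
by rewrite sumrB; lra.
Qed.

Lemma rel_merge s m l v i j : bisublinear s -> rel_nneg s m ->
    (#|tsupp l v| <= m)%N -> \sum_i (l i)^T *m v i = 0 ->
    i \in tsupp l v -> j \in tsupp l v -> i != j -> det2 (v i) (v j) = 0 ->
  0 <= \sum_i s (l i) (v i).
Proof.
move=> sb IH lm h0 iS jS ij vij.
have [|c vj] := det2_eq0 _ vij; first by move: iS; rewrite inE => /andP[].
apply: (@rel_shrink s m l v (fun k => (k == j)%:R) i j (c *: l j)) => //.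
- by move=> k _; rewrite lern1 leq_b1.
- by rewrite eqxx.
- rewrite (bigD1 j)//= eqxx scale1r big1 ?addr0.
    by rewrite vj -scalemxAr linearZ /= -scalemxAl.
  by move=> k /negbTE->; rewrite scale0r.
- rewrite (bigD1 j)//= eqxx mul1r big1 ?addr0; last first.
    by move=> k /negbTE->; rewrite mul0r.
  by rewrite vj (bisubZ sb).
Qed.

(* Subtracting from the relation the largest admissible multiple of [d] kills a
   term; the rank one remainder is absorbed by the term [p] or [q] left over. *)
Lemma rel_reduce s m l v d p q a b i1 : bisublinear s -> rel_nneg s m ->
    (#|tsupp l v| <= m)%N -> \sum_i (l i)^T *m v i = 0 ->
    p \in tsupp l v -> q \in tsupp l v -> p != q ->
    i1 \in tsupp l v -> 0 < d i1 ->
    \sum_k d k *: ((l k)^T *m v k) = a^T *m v p -> a^T *m v p = (l q)^T *m b ->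
    s a (v p) = s (l q) b ->
    s a (v p) <= \sum_k d k * s (l k) (v k) ->
  0 <= \sum_i s (l i) (v i).
Proof.
move=> sb IH lm h0 pS qS pq iS di hd ab sab hs.
case: (@arg_maxP _ _ _ i1 (mem (tsupp l v)) d iS) => i0 /= i0S d_max.
have di0 : 0 < d i0 by apply: lt_le_trans di (d_max _ iS).
pose d' k := d k / d i0.
have d'_le1 k : k \in tsupp l v -> d' k <= 1.
  by move=> kS; rewrite ler_pdivrMr// mul1r; apply: d_max.
have d'i0 : d' i0 = 1 by rewrite /d' divff// gt_eqF.
have hd' : \sum_k d' k *: ((l k)^T *m v k) = (d i0)^-1 *: (a^T *m v p).
  by rewrite -hd scaler_sumr; apply: eq_bigr => k _; rewrite scalerA mulrC.
have hs' : (d i0)^-1 * s a (v p) <= \sum_k d' k * s (l k) (v k).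
  rewrite (_ : \sum__ _ = (d i0)^-1 * \sum_k d k * s (l k) (v k)).
    by rewrite ler_pM2l ?invr_gt0.
  by rewrite mulr_sumr; apply: eq_bigr => k _; rewrite /d' mulrA [d k / _]mulrC.
have dV : 0 <= (d i0)^-1 by rewrite invr_ge0 ltW.
(* If the term killed is [p] itself, the remainder is absorbed by [q], with which it shares the left
   factor. *)
have [pi0|pi0] := eqVneq p i0.
  rewrite (eq_bigr (fun i => flip s (v i) (l i)))//.
  apply: (@rel_shrink (flip s) m v l d' q i0 ((d i0)^-1 *: b)) => //.
  - exact: bisublinear_flip.
  - exact: rel_nneg_flip.
  - by rewrite tsuppC.
  - exact: sum_tens_flip0.
  - by rewrite tsuppC.
  - by rewrite tsuppC.
  - by rewrite -pi0 eq_sym.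
  - by move=> k; rewrite tsuppC; apply: d'_le1.
  - rewrite sum_tens_flip hd' ab linearZ /= trmx_mul trmxK.
    by rewrite linearZ /= -scalemxAl.
  - by rewrite /flip bisubZr// -sab.
apply: (@rel_shrink s m l v d' p i0 ((d i0)^-1 *: a)) => //.
  by rewrite hd' linearZ /= -scalemxAl.
by rewrite bisubZl.
Qed.

(** * Relations in general position *)

Definition generic l v := forall i j, i \in tsupp l v -> j \in tsupp l v -> i != j ->
  det2 (l i) (l j) != 0 /\ det2 (v i) (v j) != 0.

(** Terms of one sign with sum zero all vanish, but [S] has an element besides [p] and [q], and its
    term is nonzero. *)
Lemma sum_sign (S : {set I}) (F : I -> R) p q e :
    \sum_i F i = 0 -> (forall i, i \notin S -> F i = 0) ->
    F p = 0 -> F q = 0 -> (2 < #|S|)%N ->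
    (forall i, i \in S -> i != p -> i != q -> F i != 0) ->
  exists i, [/\ i \in S, i != p, i != q & (0 < F i) = e].
Proof.
move=> F0 FS Fp Fq cS Fn0.
wlog : e F F0 FS Fp Fq Fn0 / e = true.
  move=> th; case: e; first exact: th.
  have [||||||i [iS ip iq Fi]] := th true (fun i => - F i) => //.
  - by rewrite sumrN F0 oppr0.
  - by move=> i /FS ->; rewrite oppr0.
  - by rewrite Fp oppr0.
  - by rewrite Fq oppr0.
  - by move=> i *; rewrite oppr_eq0; apply: Fn0.
  exists i; split=> //; move: Fi; rewrite oppr_gt0.
  by case: ltgtP.
move=> ->.
have [/existsP[i /and4P[*]]|/existsPn nex] :=
  boolP [exists i, [&& i \in S, i != p, i != q & 0 < F i]]; first by exists i.
have [i iS] : exists i, i \in S :\: [set p; q].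
  apply/set0Pn; rewrite -card_gt0 cardsD subn_gt0.
  apply: leq_ltn_trans cS; apply: leq_trans (subset_leq_card (subsetIr _ _)) _.
  by rewrite cards2; case: (p != q).
move: iS; rewrite !inE negb_or => /andP[/andP[ip iq] iS].
have Fle j : F j <= 0.
  have [jS|/FS->//] := boolP (j \in S).
  have [->|jp] := eqVneq j p; first by rewrite Fp.
  have [->|jq] := eqVneq j q; first by rewrite Fq.
  by have := nex j; rewrite jS jp jq /= -leNgt.
have : \sum_j - F j == 0 by rewrite sumrN F0 oppr0.
rewrite psumr_eq0 => [/allP/(_ i (mem_index_enum _))|j _]; last by rewrite oppr_ge0.
by rewrite /= oppr_eq0 (negbTE (Fn0 _ _ _ _)).
Qed.

(** The remainder of the walk shares its right factor with the term [i1] and its left factor with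
    [i4], as [rel_reduce] requires; the coefficient of [i1] is positive. *)
Lemma rel_pinwheel s m l v (i1 i2 i3 i4 : I) : bisublinear s -> rel_nneg s m ->
    (#|tsupp l v| <= m)%N -> \sum_i (l i)^T *m v i = 0 ->
    i1 \in tsupp l v -> i4 \in tsupp l v -> i1 != i4 ->
    let sigma := det2 (l i2) (l i4) * det2 (v i1) (v i3) in
    sigma * (det2 (l i1) (l i2) * det2 (v i3) (v i4)) < 0 ->
    sigma * (det2 (l i3) (l i4) * det2 (v i1) (v i2)) < 0 ->
    sigma * (det2 (l i2) (l i3) * det2 (v i1) (v i4)) < 0 ->
    sigma * (det2 (l i1) (l i4) * det2 (v i2) (v i3)) < 0 ->
  0 <= \sum_i s (l i) (v i).
Proof.
move=> sb IH lm h0 i1S i4S i14 sigma h1 h2 h3 h4.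
have [t1 [t2 [t3 [t4 [g [[t1_gt0 t2_ge0 t3_ge0 t4_ge0] [gT gs]]]]]]] :=
  bisub_pinwheel sb h1 h2 h3 h4.
pose d k := t1 * (k == i1)%:R + t2 * (k == i2)%:R + t3 * (k == i3)%:R + t4 * (k == i4)%:R.
have delta (V : lmodType R) t i (F : I -> V) : \sum_k (t * (k == i)%:R) *: F k = t *: F i.
  rewrite (bigD1 i)//= eqxx mulr1 big1 ?addr0// => k /negbTE->.
  by rewrite mulr0 scale0r.
have dE (V : lmodType R) (F : I -> V) : \sum_k d k *: F k =
    t1 *: F i1 + t2 *: F i2 + t3 *: F i3 + t4 *: F i4.
  by under eq_bigr do rewrite !scalerDl; rewrite !big_split /= !delta.
apply: (@rel_reduce s m l v d i1 i4 (g *: l i4) (g *: v i1) i1) => //.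
- rewrite /d eqxx mulr1 -!addrA ltr_wpDr// !addr_ge0// mulr_ge0//; exact: ler0n.
- by rewrite dE gT linearZ /= -scalemxAl.
- by rewrite linearZ /= -scalemxAl -scalemxAr.
- by rewrite (bisubZ sb).
- by rewrite (dE R^o (fun k => s (l k) (v k))).
Qed.

Lemma sum_tsupp (V : nmodType) l v (F : I -> V) :
  (forall i, i \notin tsupp l v -> F i = 0) ->
  \sum_i F i = \sum_(i <- enum (tsupp l v)) F i.
Proof.
move=> F0; rewrite (bigID (mem (tsupp l v))) /= [X in _ + X]big1// addr0.
by rewrite big_enum.
Qed.

Lemma det2_tsupp l v a b i : i \notin tsupp l v -> det2 a (l i) * det2 b (v i) = 0.
Proof.
rewrite inE negb_and !negbK => /orP[]/eqP->.
  by rewrite -(scale0r 0) det2Zr !mul0r.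
by rewrite -(scale0r 0) det2Zr mul0r mulr0.
Qed.

(* The four terms of a relation in general position form a pinwheel in any order. *)
Lemma rel_four s m l v : bisublinear s -> rel_nneg s m ->
    (#|tsupp l v| <= m)%N -> \sum_i (l i)^T *m v i = 0 -> generic l v ->
    #|tsupp l v| = 4%N ->
  0 <= \sum_i s (l i) (v i).
Proof.
move=> sb IH lm h0 gen c4.
have eqS a b : \sum_(i <- enum (tsupp l v)) det2 a (l i) * det2 b (v i) = 0.
  by rewrite -sum_tsupp ?tens_eq0_det2// => i; apply: det2_tsupp.
move: c4 (enum_uniq (tsupp l v)) eqS (mem_enum (tsupp l v)); rewrite cardE.
case: (enum _) => [|i1 [|i2 [|i3 [|i4 []]]]]//= _ + + memS.
rewrite !inE !negb_or => /and3P[/and3P[i12 i13 i14] /andP[i23 i24] /andP[i34 _]] eqS.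
have i1S : i1 \in tsupp l v by rewrite -memS !inE eqxx.
have i2S : i2 \in tsupp l v by rewrite -memS !inE eqxx ?orbT.
have i3S : i3 \in tsupp l v by rewrite -memS !inE eqxx ?orbT.
have i4S : i4 \in tsupp l v by rewrite -memS !inE eqxx ?orbT.
have neg (x y z t : R) : z != 0 -> t != 0 -> x * y + z * t = 0 -> (x * t) * (z * y) < 0.
  move=> z0 t0 h; rewrite (_ : _ * _ = - (z * t) ^+ 2).
    by rewrite oppr_lt0 exprn_even_gt0//= mulf_neq0.
  have e : x * y = - (z * t) by lra.
  by transitivity ((x * y) * (z * t)); [|rewrite e]; ring.
have [l12 v12] := gen _ _ i1S i2S i12; have [l13 v13] := gen _ _ i1S i3S i13.
have [l14 v14] := gen _ _ i1S i4S i14; have [l23 v23] := gen _ _ i2S i3S i23.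
have [l24 v24] := gen _ _ i2S i4S i24; have [l34 v34] := gen _ _ i3S i4S i34.
(* Pairing the relation with [l i] and [v j], for two distinct indices, leaves two opposite
   products, which [neg] turns into one of the sign conditions. *)
apply: (rel_pinwheel sb IH lm h0 i1S i4S i14 (i2 := i2) (i3 := i3)); apply: neg => //.
- have := eqS (l i2) (v i3); rewrite !big_cons big_nil !det2vv.
  by rewrite (det2C (l i2) (l i1)) (det2C (v i3) (v i1)); lra.
- have := eqS (l i4) (v i1); rewrite !big_cons big_nil !det2vv.
  by rewrite (det2C (l i4) (l i2)) (det2C (l i4) (l i3)); lra.
- have := eqS (l i2) (v i1); rewrite !big_cons big_nil !det2vv; lra.
- have := eqS (l i4) (v i3); rewrite !big_cons big_nil !det2vv.
  rewrite (det2C (l i4) (l i1)) (det2C (l i4) (l i2)) (det2C (v i3) (v i1)).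
  by rewrite (det2C (v i3) (v i2)); lra.
Qed.

(** A nonempty relation in general position has at least four terms: with fewer, a suitable pairing
    would leave a single term, which is nonzero. *)
Lemma rel_few s l v : bisublinear s -> \sum_i (l i)^T *m v i = 0 -> generic l v ->
  (#|tsupp l v| < 4)%N -> 0 <= \sum_i s (l i) (v i).
Proof.
move=> sb h0 gen.
have eqS a b : \sum_(i <- enum (tsupp l v)) det2 a (l i) * det2 b (v i) = 0.
  by rewrite -sum_tsupp ?tens_eq0_det2// => i; apply: det2_tsupp.
rewrite (@sum_tsupp _ l v); last first.
  move=> i; rewrite inE negb_and !negbK => /orP[]/eqP->.
    by rewrite (bisub0l sb).
  by rewrite (bisub0r sb).
move: (enum_uniq (tsupp l v)) eqS (mem_enum (tsupp l v)); rewrite cardE.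
case: (enum _) => [|i1 [|i2 [|i3 []]]]//= + + memS; first by rewrite big_nil.
- move=> _ eqS.
  have : i1 \in tsupp l v by rewrite -memS !inE eqxx.
  have nz (u : 'rV[R]_2) : u != 0 -> exists a, det2 a u != 0.
    by move=> /det2_perp_gt0 u0; exists (perp u); rewrite gt_eqF.
  rewrite inE => /andP[/nz[a a0] /nz[b b0]].
  by have := eqS a b; rewrite big_seq1 => /eqP; rewrite mulf_eq0 (negbTE a0) (negbTE b0).
- rewrite !inE andbT => i12 eqS.
  have i1S : i1 \in tsupp l v by rewrite -memS !inE eqxx.
  have i2S : i2 \in tsupp l v by rewrite -memS !inE eqxx ?orbT.
  have [l12 v12] := gen _ _ i1S i2S i12.
  have := eqS (l i1) (v i1); rewrite !big_cons big_nil !det2vv mul0r add0r addr0.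
  by move=> /eqP; rewrite mulf_eq0 (negbTE l12) (negbTE v12).
rewrite !inE !negb_or andbT => /andP[/andP[i12 i13] i23] eqS.
have i1S : i1 \in tsupp l v by rewrite -memS !inE eqxx.
have i2S : i2 \in tsupp l v by rewrite -memS !inE eqxx ?orbT.
have i3S : i3 \in tsupp l v by rewrite -memS !inE eqxx ?orbT.
have [l13 _] := gen _ _ i1S i3S i13; have [_ v23] := gen _ _ i2S i3S i23.
have := eqS (l i1) (v i2); rewrite !big_cons big_nil !det2vv mul0r mulr0 !add0r addr0.
by move=> /eqP; rewrite mulf_eq0 (negbTE l13) (negbTE v23).
Qed.


Lemma rel_five_pos s m l v p0 r : bisublinear s -> rel_nneg s m ->
    (#|tsupp l v| <= m)%N -> \sum_i (l i)^T *m v i = 0 -> generic l v ->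
    enum (tsupp l v) = p0 :: r -> size r = 4%N ->
    (forall i, i \in r -> 0 < det2 (v p0) (v i)) ->
  0 <= \sum_i s (l i) (v i).
Proof.
move=> sb IH lm h0 gen enumE r4 pos.
pose e k := nth p0 (p0 :: r) k.
have eS k : (k < 5)%N -> e k \in tsupp l v.
  by move=> k5; rewrite -mem_enum enumE mem_nth//= r4.
have e_inj i j : (i < 5)%N -> (j < 5)%N -> (e i == e j) = (i == j).
  by move=> i5 j5; rewrite nth_uniq -?enumE ?enum_uniq// enumE /= r4.
have eK i : i \in tsupp l v -> exists2 k, (k < 5)%N & e k = i.
  rewrite -mem_enum enumE => ir; exists (index i (p0 :: r)); last exact: nth_index.
  by rewrite -r4 -[(size r).+1]/(size (p0 :: r)) index_mem.
have nz i j : (i < 5)%N -> (j < 5)%N -> i != j ->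
    det2 (l (e i)) (l (e j)) != 0 /\ det2 (v (e i)) (v (e j)) != 0.
  by move=> i5 j5 ij; apply: gen; rewrite ?eS// e_inj.
have lnz i j : (i < 5)%N -> (j < 5)%N -> i != j -> det2 (l (e i)) (l (e j)) != 0.
  by move=> i5 j5 ij; have [] := nz i j i5 j5 ij.
have vnz i j : (i < 5)%N -> (j < 5)%N -> i != j -> det2 (v (e i)) (v (e j)) != 0.
  by move=> i5 j5 ij; have [] := nz i j i5 j5 ij.
have [|||||| a [b [c [d [[a5 b5 c5 d5] [+ +]]]]]] := @five_pinwheel
  (fun i j => 0 < det2 (l (e i)) (l (e j))) (fun i j => 0 < det2 (v (e i)) (v (e j))).
- by move=> i j i5 j5 ij; rewrite gt0_det2C// lnz.
- by move=> i j i5 j5 ij; rewrite gt0_det2C// vnz.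
- by case=> // i /= i5; apply: pos; apply: mem_nth; rewrite r4.
- move=> a b c d d5 /andP[ab bc] cd.
  by apply: (@plucker_signs_det2 _ (fun i => l (e i))); apply: lnz; lia.
- move=> a b c d d5 /andP[ab bc] cd.
  by apply: (@plucker_signs_det2 _ (fun i => v (e i))); apply: vnz; lia.
(* Pairing with [l (e k)] and [v (e j)] kills the terms [e k] and [e j]; the remaining ones are
   nonzero with sum zero, hence have both signs. *)
- move=> j k b j5 k5.
  have [||||||i [/eK[i' i'5 <-] ij ik ib]] := @sum_sign (tsupp l v)
     (fun i => det2 (l (e k)) (l i) * det2 (v (e j)) (v i)) (e j) (e k) b.
  + exact: tens_eq0_det2.
  + by move=> i; apply: det2_tsupp.
  + by rewrite det2vv mulr0.
  + by rewrite det2vv mul0r.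
  + by rewrite cardE enumE /= r4.
  + move=> i iS ij ik; rewrite mulf_neq0//.
      by have [] := gen (e k) i (eS _ k5) iS; rewrite 1?eq_sym.
    by have [] := gen (e j) i (eS _ j5) iS; rewrite 1?eq_sym.
  rewrite !e_inj// in ij ik.
  exists i'; split => //; rewrite -ib mulr_gt0_eqb//; [apply: lnz|apply: vnz] => //.
    by rewrite eq_sym.
  by rewrite eq_sym.
rewrite /= !inE !negb_or => /and4P[/and3P[ab ac ad] /andP[bc bd] cd _].
rewrite /pinwheel; do 3 case: ifPn => //; move=> h1 h2 h3 h4.
apply: (rel_pinwheel sb IH lm h0 (eS _ a5) (eS _ d5) _ (i2 := e b) (i3 := e c)).
- by rewrite e_inj.
- by apply: nmulr_lt0_eqb; rewrite ?lnz ?vnz// eq_sym.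
- by apply: nmulr_lt0_eqb; rewrite ?lnz ?vnz// eq_sym.
- by apply: nmulr_lt0_eqb; rewrite ?lnz ?vnz// eq_sym.
- by apply: nmulr_lt0_eqb; rewrite ?lnz ?vnz// eq_sym.
Qed.

(** Changing the signs of both factors alters neither the rank one matrix nor [s]; this makes the
    determinants of [v p0] with the other [v i] positive. *)
Lemma rel_five s m l v : bisublinear s -> rel_nneg s m ->
    (#|tsupp l v| <= m)%N -> \sum_i (l i)^T *m v i = 0 -> generic l v ->
    #|tsupp l v| = 5%N ->
  0 <= \sum_i s (l i) (v i).
Proof.
move=> sb IH lm h0 gen; rewrite cardE.
case enumE: (enum _) => [//|p0 r] [r4].
pose sg i (x : 'rV[R]_2) := if det2 (v p0) (v i) < 0 then - x else x.
pose l' i := sg i (l i); pose v' i := sg i (v i).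
have suppE : tsupp l' v' = tsupp l v.
  by apply/setP => i; rewrite !inE /l' /v' /sg; case: ifP => //; rewrite !oppr_eq0.
have sg0 i j x y : (det2 (sg i x) (sg j y) == 0) = (det2 x y == 0).
  by rewrite /sg; do 2 case: ifP => _ //; rewrite ?det2Nl ?det2Nr ?oppr_eq0.
rewrite (eq_bigr (fun i => s (l' i) (v' i))); last first.
  by move=> i _; rewrite /l' /v' /sg; case: ifP => // _; rewrite (bisubNN sb).
apply: (@rel_five_pos s m l' v' p0 r) => //.
- by rewrite suppE.
- apply: etrans h0; apply: eq_bigr => i _; rewrite /l' /v' /sg; case: ifP => // _.
  by rewrite [(- _)^T]linearN mulmxN mulNmx opprK.
- by move=> i j; rewrite suppE !sg0; apply: gen.
- by rewrite suppE.
move=> i ir; have ip0 : p0 != i.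
  by apply: contraTneq ir => <-; have := enum_uniq (tsupp l v); rewrite enumE => /andP[].
have [_] : det2 (l p0) (l i) != 0 /\ det2 (v p0) (v i) != 0.
  by apply: gen => //; rewrite -mem_enum enumE inE ?ir ?eqxx ?orbT.
rewrite /v' /sg det2vv ltxx; case: (ltgtP (det2 (v p0) (v i)) 0) => // h _.
by rewrite det2Nr oppr_gt0.
Qed.

(** Up to sign, the second relation [d] has nonnegative cost; it is subtracted if one of its
    coefficients is positive. Otherwise [- d] is subtracted: its cost is nonnegative by induction,
    as it has fewer terms. *)
Lemma rel_extra s m l v d : bisublinear s -> rel_nneg s m ->
    (#|tsupp l v| <= m)%N -> \sum_i (l i)^T *m v i = 0 -> (1 < #|tsupp l v|)%N ->
    \sum_i d i *: ((l i)^T *m v i) = 0 ->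
    (#|tsupp (fun i => d i *: l i) v| < #|tsupp l v|)%N ->
    (exists2 i, i \in tsupp l v & d i != 0) ->
  0 <= \sum_i s (l i) (v i).
Proof.
move=> sb IH lm h0 /card_gt1P[p [q [pS qS pq]]].
have pos e i1 : \sum_i e i *: ((l i)^T *m v i) = 0 -> i1 \in tsupp l v -> 0 < e i1 ->
    0 <= \sum_i e i * s (l i) (v i) -> 0 <= \sum_i s (l i) (v i).
  move=> eT i1S e_gt0 e_ge0.
  apply: (@rel_reduce s m l v e p q 0 0 i1) => //.
  - by rewrite eT trmx0 mul0mx.
  - by rewrite trmx0 mul0mx mulmx0.
  - by rewrite (bisub0l sb) (bisub0r sb).
  - by rewrite (bisub0l sb).
wlog : d / 0 <= \sum_i d i * s (l i) (v i).
  move=> th dT dc [i iS di].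
  have [|/ltW dneg] := leP 0 (\sum_i d i * s (l i) (v i)).
    by move=> /th; apply => //; exists i.
  apply: (th (fun i => - d i)).
  - by under eq_bigr do rewrite mulNr; rewrite sumrN oppr_ge0.
  - by under eq_bigr do rewrite scaleNr; rewrite sumrN dT oppr0.
  - move: dc; rewrite (_ : tsupp (fun i => - d i *: _) v = tsupp (fun i => d i *: l i) v)//.
    by apply/setP => k; rewrite !inE scaleNr oppr_eq0.
  - by exists i => //; rewrite oppr_eq0.
move=> d_ge0 dT dc [i iS di].
have [/existsP[k /andP[kS dk]]|/existsPn nex] :=
  boolP [exists k, (k \in tsupp l v) && (0 < d k)]; first exact: (pos d k).
have d_le0 k : k \in tsupp l v -> d k <= 0.
  by move=> kS; have := nex k; rewrite kS /= -leNgt.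
apply: (pos (fun i => - d i) i) => //.
- by under eq_bigr do rewrite scaleNr; rewrite sumrN dT oppr0.
- by rewrite oppr_gt0 lt_neqAle di d_le0.
have -> : \sum_k - d k * s (l k) (v k) = \sum_k s (- d k *: l k) (v k).
  apply: eq_bigr => k _; have [kS|] := boolP (k \in tsupp l v).
    by rewrite (bisubZl sb)// oppr_ge0 d_le0.
  rewrite inE negb_and !negbK => /orP[]/eqP->.
    by rewrite scaler0 (bisub0l sb) mulr0.
  by rewrite !(bisub0r sb) mulr0.
apply: IH.
  rewrite (_ : tsupp _ v = tsupp (fun i => d i *: l i) v); first exact: leq_trans dc lm.
  by apply/setP => k; rewrite !inE scaleNr oppr_eq0.
under eq_bigr do rewrite linearZ /= -scalemxAl scaleNr.
by rewrite sumrN dT oppr0.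
Qed.

(* Any five of the terms are linearly dependent in the space of 2 x 2 matrices. *)
Lemma rel_many s m l v : bisublinear s -> rel_nneg s m ->
    (#|tsupp l v| <= m)%N -> \sum_i (l i)^T *m v i = 0 ->
    (5 < #|tsupp l v|)%N ->
  0 <= \sum_i s (l i) (v i).
Proof.
move=> sb IH lm h0 c5.
have /card_gt0P[p0 p0S] : (0 < #|tsupp l v|)%N by apply: leq_trans c5.
pose e (k : 'I_5) := nth p0 (enum (tsupp l v)) k.
have ltS (k : 'I_5) : (k < size (enum (tsupp l v)))%N.
  by rewrite -cardE; apply: leq_trans (ltn_ord k) (ltnW c5).
have eS k : e k \in tsupp l v by rewrite -mem_enum mem_nth.
have e_inj : injective e.
  move=> i j /eqP; rewrite nth_uniq ?enum_uniq// => /eqP h; exact: val_inj.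
pose M := \matrix_(k < 5) mxvec ((l (e k))^T *m v (e k)).
have /rowV0Pn[u /sub_kermxP uM u0] : kermx M != 0.
  by rewrite kermx_eq0; apply/eqP => rk; have := rank_leq_col M; rewrite rk.
have /rV0Pn[k uk] := u0.
pose d i := \sum_(j < 5 | i == e j) u 0 j.
have de j : d (e j) = u 0 j.
  by rewrite /d (big_pred1 j)// => j'; rewrite (inj_eq e_inj).
have d0 i : i \notin codom e -> d i = 0.
  by move=> ie; rewrite /d big_pred0// => j; apply: contraNF ie => /eqP->; apply: codom_f.
apply: (@rel_extra s m l v d) => //.
- exact: leq_trans c5.
- under eq_bigr do rewrite scaler_suml.
  rewrite (exchange_big_dep predT)//=.
  under eq_bigr do rewrite big_pred1_eq.
  apply: (can_inj mxvecK); rewrite linear0 -uM mulmx_sum_row linear_sum.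
  by apply: eq_bigr => j _; rewrite rowK linearZ.
- apply: leq_ltn_trans c5; rewrite -[5%N]card_ord -(card_codom e_inj).
  apply/subset_leq_card/fintype.subsetP => i; rewrite inE => /andP[dl _].
  by apply: contraR dl => /d0 ->; rewrite scale0r.
- by exists (e k) => //; rewrite de.
Qed.

Theorem rel_bisublinear s l v : bisublinear s ->
  \sum_i (l i)^T *m v i = 0 -> 0 <= \sum_i s (l i) (v i).
Proof.
move=> sb; suff IH m : rel_nneg s m by apply: (IH #|tsupp l v|.+1).
elim: m => [//|m IH] {}l {}v; rewrite ltnS => lm h0.
have [/existsP[i /andP[iS /existsP[j /and3P[jS ij /eqP vij]]]]|/existsPn vgen] :=
  boolP [exists i, (i \in tsupp l v) &&
    [exists j, [&& j \in tsupp l v, i != j & det2 (v i) (v j) == 0]]].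
  exact: (rel_merge sb IH lm h0 iS jS ij vij).
have [/existsP[i /andP[iS /existsP[j /and3P[jS ij /eqP lij]]]]|/existsPn lgen] :=
  boolP [exists i, (i \in tsupp l v) &&
    [exists j, [&& j \in tsupp l v, i != j & det2 (l i) (l j) == 0]]].
  rewrite tsuppC in iS jS lm.
  have flip0 := sum_tens_flip0 h0.
  exact: (rel_merge (bisublinear_flip sb) (rel_nneg_flip IH) lm flip0 iS jS ij lij).
have gen : generic l v.
  move=> i j iS jS ij; have := vgen i; have := lgen i; rewrite iS /=.
  by move=> /existsPn/(_ j) + /existsPn/(_ j); rewrite jS ij.
case: (ltngtP #|tsupp l v| 5) => [|c5|c5].
- rewrite ltnS leq_eqVlt => /orP[/eqP c4|c4]; first exact: (rel_four sb IH).
  exact: rel_few.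
- exact: (rel_many sb IH).
- exact: (rel_five sb IH).
Qed.

End Relations.

Local Open Scope classical_set_scope.
Local Open Scope ring_scope.

(** * Bilinear minorants *)

(** For homogeneity only an inequality is asked, which is what infima give directly; [sublinZE]
    recovers the equality. *)
Record sublinear (R : realType) (V : lmodType R) (p : V -> R) : Prop := {
  sublinD : forall x y, p (x + y) <= p x + p y;
  sublinZ : forall c x, 0 < c -> p (c *: x) <= c * p x }.

Section Sublinear.
Variables (R : realType) (V : lmodType R).
Implicit Types (p q : V -> R) (x y e : V).

Lemma sublin0 p : sublinear p -> p 0 = 0.
Proof.
move=> sp; have := sublinZ sp 0 (ltr0n R 2); have := @sublinZ _ _ _ sp 2^-1 0.
by rewrite !scaler0 => h1 h2; have := h1 ltac:(lra); lra.
Qed.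

Lemma sublin_opp p x : sublinear p -> - p (- x) <= p x.
Proof. by move=> sp; have := sublinD sp x (- x); rewrite subrr sublin0//; lra. Qed.

Lemma sublinZE p c x : sublinear p -> 0 <= c -> p (c *: x) = c * p x.
Proof.
move=> sp; rewrite le_eqVlt => /predU1P[<-|c0]; first by rewrite scale0r mul0r sublin0.
apply/eqP; rewrite eq_le sublinZ//= mulrC -ler_pdivlMr// mulrC.
have := sublinZ sp (c *: x) (_ : 0 < c^-1); rewrite scalerA mulVf ?gt_eqF//.
by rewrite scale1r invr_gt0; apply.
Qed.

Lemma sublin_sum p (I : Type) (r : seq I) (F : I -> V) : sublinear p ->
  p (\sum_(i <- r) F i) <= \sum_(i <- r) p (F i).
Proof.
move=> sp; elim/big_ind2 : _ => [|x a y b xa yb|//]; first by rewrite sublin0.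
exact: le_trans (sublinD sp _ _) (lerD xa yb).
Qed.

(* The one step extension of the Hahn-Banach theorem. *)
Lemma sublin_step p e : sublinear p ->
  exists p', [/\ sublinear p', forall x, p' x <= p x & p' (- e) <= - p' e].
Proof.
move=> sp.
(* In the infimum, [t = 0] gives the bound [p x]; at [- e], the choice [t = 1] gives the bound
   [- p e]. *)
pose D x := [set p (x + t *: e) - t * p e | t in [set t | 0 <= t]].
have Dn0 x : D x !=set0 by exists (p (x + 0 *: e) - 0 * p e), 0 => /=.
have Dlb x : lbound (D x) (- p (- x)).
  move=> _ [t /= t0 <-]; have := sublinD sp (- x) (x + t *: e).
  by rewrite addKr sublinZE//; lra.
have Dinf x : has_inf (D x) by split => //; exists (- p (- x)).
have infle x t : 0 <= t -> inf (D x) <= p (x + t *: e) - t * p e.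
  by move=> t0; apply: ge_inf; [exists (- p (- x))|exists t].
have p'le x : inf (D x) <= p x.
  by have := infle x 0 (lexx 0); rewrite scale0r addr0 mul0r subr0.
exists (fun x => inf (D x)); split=> //.
  split=> [x y|c x c0].
    rewrite -lerBlDr; apply: lb_le_inf => // _ [t /= t0 <-].
    rewrite lerBlDl -lerBlDr; apply: lb_le_inf => // _ [t' /= t'0 <-].
    rewrite lerBlDl; apply: le_trans (infle _ (t + t') _) _; first exact: addr_ge0.
    have := sublinD sp (x + t *: e) (y + t' *: e).
    by rewrite scalerDl addrACA; lra.
  rewrite -ler_pdivrMl//; apply: lb_le_inf => // _ [t /= t0 <-].
  rewrite ler_pdivrMl//; apply: le_trans (infle _ (c * t) _) _.
    by rewrite mulr_ge0// ltW.
  by rewrite -scalerA -scalerDr (sublinZE _ sp (ltW c0)) mulrBr mulrA.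
have := infle (- e) 1 ler01; rewrite scale1r addNr sublin0// mul1r sub0r => /le_trans.
by apply; rewrite lerN2.
Qed.

Lemma sublin_steps p (r : seq V) : sublinear p ->
  exists p', [/\ sublinear p', forall x, p' x <= p x &
    forall e, e \in r -> p' (- e) <= - p' e].
Proof.
move=> sp; elim: r => [|e r [q [sq qp qr]]]; first by exists p.
have [q' [sq' q'q q'e]] := sublin_step e sq.
exists q'; split=> // [x|e']; first exact: le_trans (q'q x) (qp x).
rewrite inE => /predU1P[->//|e'r].
apply: le_trans (q'q _) (le_trans (qr _ e'r) _).
by rewrite lerN2.
Qed.

End Sublinear.

(** Once [p] has been lowered to a function [q] linear along each matrix unit, the values of [q]
    there are the coefficients of a linear minorant. *)
Lemma sublin_mx (R : realType) m n (p : 'M[R]_(m, n) -> R) : sublinear p ->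
  exists b : 'M[R]_(m, n), forall X : 'M[R]_(m, n), \sum_i \sum_j X i j * b i j <= p X.
Proof.
move=> sp; have [q [sq qp qr]] :=
  sublin_steps [seq delta_mx ij.1 ij.2 | ij : 'I_m * 'I_n] sp.
exists (\matrix_(i, j) q (delta_mx i j)) => X; apply: le_trans (qp X).
(* Subadditivity bounds [q] from above only, so it is applied to [- X], together with
   [- q (- X) <= q X]. *)
rewrite -[leLHS]opprK; apply: le_trans (sublin_opp X sq); rewrite lerN2.
have qZ c i j : q (c *: delta_mx i j) <= c * q (delta_mx i j).
  have [c0|c0] := leP 0 c; first by rewrite sublinZE.
  have := qr (delta_mx i j) (map_f _ (mem_enum _ (i, j))).
  rewrite -(ler_pM2l (_ : 0 < - c)) ?oppr_gt0// mulrNN.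
  rewrite -(sublinZE (- delta_mx i j) sq (_ : 0 <= - c)); last first.
    by rewrite oppr_ge0 ltW.
  by rewrite scalerN scaleNr opprK.
rewrite {1}[- X]matrix_sum_delta -sumrN; apply: le_trans (sublin_sum _ _ sq) _.
apply: ler_sum => i _; rewrite -sumrN; apply: le_trans (sublin_sum _ _ sq) _.
by apply: ler_sum => j _; apply: le_trans (qZ _ _ _) _; rewrite !mxE mulNr.
Qed.

Section BilinearMinorant.
Variables (R : realType) (s : 'rV[R]_2 -> 'rV[R]_2 -> R).
Hypothesis sb : bisublinear s.

Let tens (r : seq ('rV[R]_2 * 'rV[R]_2)) := \sum_(x <- r) x.1^T *m x.2.
Let cost (r : seq ('rV[R]_2 * 'rV[R]_2)) := \sum_(x <- r) s x.1 x.2.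
Let opp (r : seq ('rV[R]_2 * 'rV[R]_2)) := [seq (- x.1, x.2) | x <- r].
Let decomp (X : 'M[R]_2) : seq ('rV[R]_2 * 'rV[R]_2) :=
  [seq (delta_mx 0 i, row i X) | i : 'I_2].

Let cost_ge0 r : tens r = 0 -> 0 <= cost r.
Proof.
rewrite /tens /cost !(big_nth (0, 0)) !big_mkord => h.
exact: (@rel_bisublinear R 'I_(size r) s (fun i => (nth (0, 0) r i).1)
  (fun i => (nth (0, 0) r i).2)).
Qed.

Let tens_decomp X : tens (decomp X) = X.
Proof.
rewrite /tens big_map big_enum /=; apply/matrixP => a b.
rewrite summxE (bigD1 a)//= big1 ?addr0 => [|i ia]; rewrite !mxE big_ord1 !mxE.
  by rewrite !eqxx mul1r.
by rewrite [a == i]eq_sym (negbTE ia) andbF mul0r.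
Qed.

Let tens_opp r : tens (opp r) = - tens r.
Proof.
rewrite /tens big_map -sumrN; apply: eq_bigr => x _.
by rewrite linearN mulNmx.
Qed.

(** The infimum of the costs of the decompositions of [X] is finite: one of [X] and one of [- X]
    together form a relation, of nonnegative cost by [rel_bisublinear]. A linear minorant of it is
    compared with [s] on one-term decompositions. *)
Lemma bilinear_minorant : exists b : 'M[R]_2, forall l v : 'rV[R]_2,
  \sum_i \sum_j l 0 i * v 0 j * b i j <= s l v.
Proof.
pose D X := [set cost r | r in [set r | tens r = X]].
have Dn0 X : D X !=set0 by exists (cost (decomp X)), (decomp X) => //=; exact: tens_decomp.
have Dlb X : lbound (D X) (- cost (opp (decomp X))).
  move=> _ [r /= rX <-]; rewrite -subr_ge0 opprK addrC -big_cat; apply: cost_ge0.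
  by rewrite /tens big_cat /= [X in X + _]tens_opp tens_decomp [X in _ + X]rX addNr.
have infle r : inf (D (tens r)) <= cost r.
  by apply: ge_inf; [exists (- cost (opp (decomp (tens r))))|exists r].
have sD : sublinear (fun X => inf (D X)).
  split=> [X Y|c X c0].
    rewrite -lerBlDr; apply: lb_le_inf => // _ [r /= rX <-].
    rewrite lerBlDl -lerBlDr; apply: lb_le_inf => // _ [r' /= rY <-].
    rewrite lerBlDl; have := infle (r ++ r').
    by rewrite /tens /cost !big_cat /= [X in X + _]rX [X in _ + X]rY.
  rewrite -ler_pdivrMl//; apply: lb_le_inf => // _ [r /= rX <-].
  rewrite ler_pdivrMl//; have := infle [seq (c *: x.1, x.2) | x <- r].
  rewrite /tens /cost !big_map /= mulr_sumr.
  under [X in _ <= X -> _]eq_bigr do rewrite (bisubZl sb _ _ (ltW c0)).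
  rewrite (_ : \sum_(_ <- _) _ = c *: X)// -rX scaler_sumr.
  by apply: eq_bigr => x _; rewrite linearZ /= -scalemxAl.
have [b bD] := sublin_mx sD; exists b => l v.
have := infle [:: (l, v)]; rewrite /tens /cost !big_seq1; apply: le_trans.
apply: le_trans (bD _); apply: ler_sum => i _; apply: ler_sum => j _.
by rewrite !mxE big_ord1 !mxE.
Qed.

End BilinearMinorant.

(** * Separation in the plane *)

Lemma mulmxr_continuous (R : realType) n (E : 'M[R]_(2, n)) :
  continuous (fun x : 'rV[R]_2 => x *m E).
Proof.
have -> : (fun x : 'rV[R]_2 => x *m E) = fun x => x 0 0 *: row 0 E + x 0 1 *: row 1 E.
  apply/funext => x; rewrite mulmx_sum_row 2!big_ord_recl big_ord0 addr0.
  by rewrite (_ : lift ord0 ord0 = 1)//; apply: val_inj.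
by move=> x; apply: (@cvgD _ _ _ (nbhs x)); apply: (@cvgZr_tmp _ _ _ (nbhs x));
  exact: coord_continuous.
Qed.

Section Separation.
Variables (R : realType) (K : set 'rV[R]_2).
Hypotheses (Kn0 : K !=set0) (Kcl : closed K)
  (Kbnd : forall t, exists M, forall x, K x -> `|det2 t x| <= M)
  (Kcvx : forall x y c, K x -> K y -> 0 <= c <= 1 -> K (c *: x + (1 - c) *: y)).

Let Kcompact : compact K.
Proof.
apply: bounded_closed_compact Kcl.
(* These two functionals are, up to sign, the second and the first coordinate. *)
have [M1 h1] := Kbnd (delta_mx 0 0); have [M2 h2] := Kbnd (delta_mx 0 1).
exists (`|M1| + `|M2|); split=> [|M' MM' x Kx /=]; first exact: num_real.
rewrite [leLHS]mx_normrE; apply: bigmax_le.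
  by apply: le_trans (ltW MM'); rewrite addr_ge0.
case=> i j _ /=; rewrite ord1; apply: le_trans (ltW MM').
have /orP[/eqP->|/eqP->] : (j == 0) || (j == 1) by case: j => [[|[]]].
- have := h2 _ Kx; rewrite /det2 !mxE /= mul0r mul1r sub0r normrN => h.
  by rewrite (le_trans h)// (le_trans (ler_norm _))// lerDr.
- have := h1 _ Kx; rewrite /det2 !mxE /= mul0r mul1r subr0 => h.
  by rewrite (le_trans h)// (le_trans (ler_norm _))// lerDl.
Qed.

(** The functional is the inner product with [x - p], where [p] is the point of [K] nearest to [x]:
    if [k] had a larger value, moving from [p] towards [k] would come closer to [x]. *)
Lemma separation x : ~ K x ->
  exists t M, (forall k, K k -> det2 t k <= M) /\ M < det2 t x.
Proof.
move=> Kx; pose f (k : 'rV[R]_2) :=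
  (x 0 0 - k 0 0) * (x 0 0 - k 0 0) + (x 0 1 - k 0 1) * (x 0 1 - k 0 1).
have fcont : continuous f.
  by move=> k; apply: (@cvgD _ _ _ (nbhs k)); apply: (@cvgM _ _ (nbhs k));
    apply: (@cvgB _ _ _ (nbhs k)); by [exact: cvg_cst|exact: coord_continuous].
have [p] := EVT_min_rV Kn0 Kcompact (continuous_subspaceT fcont).
rewrite inE => Kp pmin; exists (perp (x - p)), (det2 (perp (x - p)) p).
have xp : x - p != 0 by apply: contra_not_neq Kx => /subr0_eq->.
have dx : det2 (perp (x - p)) x = det2 (perp (x - p)) p + det2 (perp (x - p)) (x - p).
  by rewrite -det2Dr (addrC p) subrK.
split; last by rewrite dx ltrDl det2_perp_gt0.
move=> k Kk; rewrite leNgt; apply/negP => lt_pk.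
pose e := det2 (perp (x - p)) (k - p); pose n := det2 (perp (k - p)) (k - p).
have e_gt0 : 0 < e.
  by rewrite /e -[ltRHS](addrK (det2 (perp (x - p)) p)) -det2Dr subrK subr_gt0.
have n_gt0 : 0 < n.
  by apply: det2_perp_gt0; rewrite subr_eq0; apply: contraTneq lt_pk => ->; rewrite ltxx.
have pmin' c : 0 <= c <= 1 -> 2 * c * e <= c ^+ 2 * n.
  move=> c01; have := pmin (c *: k + (1 - c) *: p); rewrite inE => /(_ (Kcvx Kk Kp c01)).
  by rewrite /f /e /n !det2_perp !mxE => h; rewrite -subr_ge0; move: h; rewrite -subr_ge0;
     apply: etrans; congr (0 <= _); ring.
(* As [c <= e / n], the inequality [pmin'] gives [2 * c * e <= c * e], although [c] and [e] are
   positive. *)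
have := pmin' (Num.min 1 (e / n)).
rewrite le_min ler01 (divr_ge0 (ltW e_gt0) (ltW n_gt0)) ge_min lexx /= => /(_ isT).
set c := Num.min _ _; have c_gt0 : 0 < c by rewrite lt_min ltr01 divr_gt0.
have cn : c * n <= e by rewrite -ler_pdivlMr// ge_min lexx orbT.
by nra.
Qed.

End Separation.

(** * Sections of a convex-concave set *)

Section VspaceLines.
Variables (F : fieldType) (vT : vectType F).
Implicit Types (U T p : {vspace vT}) (x y z : vT).

Lemma dim_add_line U y : y \notin U -> \dim (U + <[y]>) = (\dim U).+1.
Proof.
move=> yU; rewrite dimv_disjoint_sum.
  by rewrite dim_vline (contraNneq _ yU) ?addn1// => ->; rewrite mem0v.
apply/eqP; rewrite -subv0; apply/subvP => z; rewrite memv_cap memv0 => /andP[+ /vlineP[k zE]].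
rewrite {}zE; have [->|k0] := eqVneq k 0; first by rewrite scale0r.
by rewrite rpredZeq (negbTE k0) (negbTE yU).
Qed.

Lemma dim1_line p : \dim p = 1%N -> exists2 x, x != 0 & p = <[x]>%VS.
Proof.
move=> p1; have x0 : vpick p != 0 by rewrite vpick0 -dimv_eq0 p1.
exists (vpick p) => //; apply/esym/eqP; rewrite eqEdim.
by rewrite -memvE memv_pick p1 dim_vline x0.
Qed.

Lemma add_line_eq T y z c : c != 0 -> z - c *: y \in T ->
  (T + <[z]> = T + <[y]>)%VS.
Proof.
move=> c0 zyT; apply/eqP; rewrite eqEsubv !subv_add !addvSl /= -!memvE.
apply/andP; split; apply/memv_addP.
  by exists (z - c *: y) => //; exists (c *: y); [exact/memvZ/memv_line|rewrite subrK].
exists (- c^-1 *: (z - c *: y)); first exact: memvZ.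
exists (c^-1 *: z); first exact/memvZ/memv_line.
by rewrite scaleNr scalerBr scalerA mulVf// scale1r opprB subrK.
Qed.

Lemma vlineZ c y : c != 0 -> <[c *: y]>%VS = <[y]>%VS.
Proof.
move=> c0; have := @add_line_eq 0%VS y (c *: y) c c0.
by rewrite subrr mem0v !add0v => ->.
Qed.

End VspaceLines.

Lemma vspace2_mx (F : fieldType) n (U : {vspace 'rV[F]_n}) : \dim U = 2%N ->
  exists E : 'M[F]_(2, n), [/\ forall x : 'rV_2, x *m E \in U,
    forall y, y \in U -> exists x : 'rV_2, y = x *m E &
    forall x : 'rV_2, x *m E = 0 -> x = 0].
Proof.
move=> dU; have := vbasisP U; move: (vbasis U); rewrite dU => b bU.
exists (\matrix_i b`_i).
have mE (x : 'rV[F]_2) : x *m \matrix_(i < 2) b`_i = \sum_i x 0 i *: b`_i.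
  by rewrite mulmx_sum_row; under eq_bigr do rewrite rowK.
split=> [x|y yU|x].
- rewrite mE memv_suml// => i _; rewrite memvZ//.
  by rewrite (basis_mem bU)// mem_nth ?size_tuple.
- exists (\row_i coord b i y); rewrite mE {1}(coord_basis bU yU).
  by apply: eq_bigr => i _; rewrite mxE.
rewrite mE => x0; have /freeP b_free := basis_free bU.
by apply/rowP => i; rewrite mxE; apply: (b_free (fun i => x 0 i)).
Qed.

Lemma vspace2_coord (F : fieldType) (L : {vspace 'rV[F]_4}) : \dim L = 2%N ->
  exists E Q : 'M[F]_(2, 4), [/\ forall x : 'rV_2, x *m E \in L,
    forall y, y \in L -> exists x : 'rV_2, y = x *m E,
    forall x : 'rV_2, x *m E = 0 -> x = 0 &
    forall v : 'rV_2, v *m Q \in L -> v = 0].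
Proof.
move=> dL; have [E [EL LE E0]] := vspace2_mx dL.
have dQ : \dim L^C = 2%N.
  by rewrite dimv_compl dL dimvf.
have [Q [QL _ Q0]] := vspace2_mx dQ.
exists E, Q; split=> // v vL.
by apply: Q0; apply/eqP; rewrite -memv0 -(capv_compl L) memv_cap vL QL.
Qed.

Lemma convex_set_comb (R : realType) (V : lmodType R) (S : set V) (x y : V) (c : R) :
  convex_set S -> S x -> S y -> 0 <= c <= 1 -> S (c *: x + (1 - c) *: y).
Proof.
move=> cS Sx Sy /andP[c0 c1].
by have := cS x y (Itv01 c0 c1); rewrite !inE; apply.
Qed.

Lemma frac01 (R : realFieldType) (p q : R) :
  0 <= p * q -> p + q != 0 -> 0 <= p / (p + q) <= 1.
Proof.
move=> pq pq0; have frac_ge0 (x y : R) : 0 <= x * y -> x + y != 0 -> 0 <= x / (x + y).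
  move=> xy xy0; rewrite (_ : _ / _ = x * (x + y) / (x + y) ^+ 2); last by field.
  by rewrite divr_ge0 ?sqr_ge0// mulrDr addr_ge0// -expr2 sqr_ge0.
rewrite frac_ge0//= -subr_ge0 (_ : 1 - _ = q / (q + p)).
  by apply: frac_ge0; rewrite 1?mulrC 1?addrC.
by rewrite [q + p]addrC; field.
Qed.

Section Sections.
Variables (R : realType) (L : {vspace 'rV[R]_4}) (A : set {vspace 'rV[R]_4}).
Variables E Q : 'M[R]_(2, 4).
Hypotheses (dL : \dim L = 2%N) (hA : A `<=` pspace 0%VS fullv).
Hypothesis hLA : L_convex_concave L A.
Hypotheses (EL : forall x : 'rV_2, x *m E \in L)
  (LE : forall y, y \in L -> exists x : 'rV_2, y = x *m E)
  (E0 : forall x : 'rV_2, x *m E = 0 -> x = 0)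
  (QL : forall v : 'rV_2, v *m Q \in L -> v = 0).

Definition emb (x v : 'rV[R]_2) := x *m E + v *m Q.

(** The set A_v introduced above, in the coordinates of [L] given by [E]. *)
Definition sec v := [set x | A <[emb x v]>%VS].

Lemma embZ c x v : emb (c *: x) (c *: v) = c *: emb x v.
Proof. by rewrite /emb -!scalemxAl scalerDr. Qed.

Lemma embD x x' v v' : emb (x + x') (v + v') = emb x v + emb x' v'.
Proof. by rewrite /emb !mulmxDl addrACA. Qed.

Lemma embx0 x : emb x 0 = x *m E.
Proof. by rewrite /emb mul0mx addr0. Qed.

Lemma emb_notin x v : v != 0 -> emb x v \notin L.
Proof.
by apply: contraNN => xvL; apply/eqP/QL; rewrite -(rpredDr _ (EL x)) addrC.
Qed.

Lemma emb_neq0 x v : v != 0 -> emb x v != 0.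
Proof. by move=> /(emb_notin x); apply: contraNneq => ->; rewrite mem0v. Qed.

Lemma pspace_line (W : {vspace 'rV[R]_4}) y : y != 0 -> y \in W -> pspace 0%VS W <[y]>%VS.
Proof. by move=> y0 yW; split; rewrite ?sub0v// dim_vline y0 dimv0. Qed.

Lemma pspace_ptZ (T : {vspace 'rV[R]_4}) c y : c != 0 -> pspace_pt T (c *: y) = pspace_pt T y.
Proof. by move=> c0; rewrite /pspace_pt vlineZ. Qed.

Lemma notinA x : ~ A <[x *m E]>%VS.
Proof.
case: hLA => _ AL _ _ Ax; have [_ _] := hA Ax; rewrite !dim_vline eqxx => x0.
have : (A `&` pspace 0%VS L) <[x *m E]>%VS.
  by split=> //; apply: pspace_line; [case: eqP x0|exact: EL].
by rewrite AL.
Qed.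

Lemma sec0 x : ~ sec 0 x.
Proof. by rewrite /sec /= embx0; apply: notinA. Qed.

Lemma secZ c v x : c != 0 -> sec (c *: v) (c *: x) <-> sec v x.
Proof. by move=> c0; rewrite /sec /= embZ vlineZ. Qed.

Lemma secN v x : sec (- v) (- x) <-> sec v x.
Proof. by rewrite -(scaleN1r v) -(scaleN1r x) secZ// oppr_eq0 oner_neq0. Qed.

Lemma hyperplane_split (N H : {vspace 'rV[R]_4}) w y :
    (H <= N)%VS -> \dim N = (\dim H).+1 ->
    w \in N -> w \notin H -> y \in N -> y \notin H ->
  exists2 a, a != 0 & a^-1 *: y - w \in H.
Proof.
move=> HN dN wN wH yN yH.
have NE : (H + <[w]>)%VS = N.
  by apply/eqP; rewrite eqEdim subv_add HN -memvE wN dim_add_line// dN /=.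
have /memv_addP[h hH [_ /vlineP[a ->] yE]] : y \in (H + <[w]>)%VS by rewrite NE.
have a0 : a != 0 by apply: contraNneq yH => a0; rewrite yE a0 scale0r addr0.
exists a => //; rewrite yE scalerDr scalerA mulVf// scale1r addrK; exact: memvZ.
Qed.

(** Condition (2) is used in the plane spanned by [L] and [v *m Q]. Scaling by [a^-1] and [b^-1]
    brings the vectors over [x] and [y] into one affine chart. *)
Lemma sec_convex v x y c : sec v x -> sec v y -> 0 <= c <= 1 ->
  sec v (c *: x + (1 - c) *: y).
Proof.
have [->|v0] := eqVneq v 0; first by move=> /sec0.
move=> vx vy /andP[c0 c1]; case: hLA => _ AL /(_ (L + <[v *m Q]>)%VS) + _.
rewrite dim_add_line ?dL; last by apply: contra_neqN v0; apply: QL.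
move=> /(_ erefl (addvSl _ _)); set N := (_ + _)%VS; set C := A `&` _.
have NE z : emb z v \in N by rewrite memv_add// memv_line.
have CE z : sec v z -> C <[emb z v]>%VS.
  by move=> vz; split=> //; apply: pspace_line => //; apply: emb_neq0.
case=> H [[_ HN dN] CH [w [wN wH convC]]].
have notH z : sec v z -> emb z v \notin H.
  move=> /CE Cz; apply/negP => zH; suff : (C `&` pspace 0%VS H) <[emb z v]>%VS by rewrite CH.
  by split=> //; apply: pspace_line => //; apply: emb_neq0.
have [a a0 aH] := hyperplane_split HN dN wN wH (NE x) (notH x vx).
have [b b0 bH] := hyperplane_split HN dN wN wH (NE y) (notH y vy).
have cvx k : 0 <= k <= 1 ->
    C <[k *: (a^-1 *: emb x v) + (1 - k) *: (b^-1 *: emb y v)]>%VS.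
  move=> k01.
  have [] := convex_set_comb (x := a^-1 *: emb x v) (y := b^-1 *: emb y v) convC _ _ k01.
  - by split=> //; rewrite pspace_ptZ ?invr_neq0// /pspace_pt add0v; apply: CE.
  - by split=> //; rewrite pspace_ptZ ?invr_neq0// /pspace_pt add0v; apply: CE.
  by rewrite /pspace_pt add0v.
have [ab|ab] : 0 < a * b \/ a * b < 0.
- by case: (ltgtP 0 (a * b)) (mulf_neq0 a0 b0) => //; [left|right].
(* Equal signs: the chart segment projects to that of [x] and [y], with weights multiplied by [a]
   and [b] and normalized by [d]. *)
- have [d dE] : exists d, d = c * a + (1 - c) * b by eexists.
  have pq : 0 <= (c * a) * ((1 - c) * b).
    by rewrite mulrACA mulr_ge0// ?(ltW ab)// mulr_ge0// subr_ge0.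
  have d0 : d != 0.
    apply/eqP => d0; have p0 : c * a = 0.
      by apply/eqP; rewrite -sqrf_eq0 eq_le sqr_ge0 andbT; nra.
    have : (1 - c) * b = 0 by lra.
    move/eqP; rewrite mulf_eq0 (negbTE b0) orbF => /eqP c1'.
    by move/eqP: p0; rewrite mulf_eq0 (negbTE a0) orbF => /eqP c0'; lra.
  have := frac01 pq; rewrite -dE => /(_ d0)/cvx[+ _].
  rewrite (_ : _ + _ = d^-1 *: emb (c *: x + (1 - c) *: y) v) ?vlineZ ?invr_neq0//.
  rewrite !scalerA (_ : 1 - _ = (1 - c) * b / d); last first.
    by rewrite -{1}(divff d0) -mulrBl {1}dE; congr (_ / _); ring.
  rewrite (_ : c * a / d / a = d^-1 * c); last by field; rewrite d0.
  rewrite (_ : (1 - c) * b / d / b = d^-1 * (1 - c)); last by field; rewrite d0.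
  rewrite -!scalerA -scalerDr; congr (_ *: _).
  by rewrite -!embZ -embD -scalerDl (addrC c) subrK scale1r.
(* Opposite signs: the chart segment, contained in [A], would pass through a multiple of
   [(x - y) *m E], a vector of [L]. *)
have ab0 : a - b != 0.
  by apply: contraTneq ab => /subr0_eq->; rewrite -leNgt -expr2 sqr_ge0.
have /(_ ab0)/cvx : a + - b != 0 -> 0 <= a / (a + - b) <= 1.
  by apply: frac01; rewrite mulrN oppr_ge0 ltW.
rewrite (_ : _ + _ = ((a - b)^-1 *: (x - y)) *m E).
  by case=> /notinA.
rewrite !scalerA (_ : 1 - _ = - (b / (a - b))); last by field.
rewrite (_ : a / (a - b) / a = (a - b)^-1); last by field; rewrite ?ab0 ?a0.
rewrite (_ : - (b / (a - b)) / b = - (a - b)^-1); last by field; rewrite ?ab0 ?b0.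
by rewrite scaleNr -scalerBr -scalemxAl /emb mulmxBl opprD addrACA subrr addr0.
Qed.



Lemma emb_continuousl v : continuous (emb^~ v).
Proof.
by move=> z; apply: (@cvgD _ _ _ (nbhs z)); [exact: mulmxr_continuous|exact: cvg_cst].
Qed.

Lemma emb_continuousr x : continuous (emb x).
Proof.
by move=> z; apply: (@cvgD _ _ _ (nbhs z)); [exact: cvg_cst|exact: mulmxr_continuous].
Qed.

Lemma sec_closed v : v != 0 -> closed (sec v).
Proof.
move=> v0; case: hLA => /open_subspaceP[V Vo VA] _ _ _.
rewrite -(setCK (sec v)); apply: open_closedC.
rewrite (_ : ~` _ = (emb^~ v) @^-1` V).
  by apply: open_comp Vo => x _; apply: emb_continuousl.
apply/seteqP; split=> x /=.
  move=> vx; suff : (V `&` [set x : 'rV[R]_4 | x \in fullv /\ x \notin 0%VS]) (emb x v).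
    by case.
  rewrite VA; split; last by rewrite /= memvf memv0 emb_neq0.
  rewrite /= /pspace_pt add0v; split=> //.
  by apply: pspace_line; rewrite ?memvf// emb_neq0.
move=> Vx; suff : (pspace_pt 0%VS @^-1` (pspace 0%VS fullv `\` A) `&`
    [set x : 'rV[R]_4 | x \in fullv /\ x \notin 0%VS]) (emb x v).
  by case; rewrite /= /pspace_pt add0v => -[].
by rewrite -VA; split=> //=; rewrite memvf memv0 emb_neq0.
Qed.

(** * Projection from a point of L *)

Section FixedPoint.
Variable t : 'rV[R]_2.
Hypothesis t0 : t != 0.

Definition coimage :=
  pspace <[t *m E]> fullv `\` [set (<[t *m E]> + p)%VS | p in A].

Lemma notin_center x v : v != 0 \/ det2 t x != 0 -> emb x v \notin <[t *m E]>%VS.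
Proof.
move=> h; apply/negP => /vlineP[k xvE].
have v0 : v = 0.
  apply: QL; rewrite (_ : v *m Q = (k *: t - x) *m E) ?EL//.
  by rewrite mulmxBl -scalemxAl -xvE /emb addrC addKr.
case: h; rewrite ?v0 ?eqxx// => /negP; apply; apply/eqP.
have -> : x = k *: t.
  by apply/subr0_eq/E0; rewrite mulmxBl -scalemxAl -xvE v0 embx0 subrr.
by rewrite det2Zr det2vv mulr0.
Qed.

(** For [v != 0], [emb z v] and [emb x v] have the same image exactly when [z - x] is a multiple of
    [t], that is when [det2 t] agrees on [z] and [x]. For [v = 0] the image is that of [L], which
    [A] avoids. *)
Lemma coimageP x v : v != 0 \/ det2 t x != 0 ->
  coimage (pspace_pt <[t *m E]> (emb x v)) <->
  (v != 0 -> forall z, sec v z -> det2 t z != det2 t x).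
Proof.
move=> h; have xvT := notin_center h.
have pT : pspace <[t *m E]> fullv (pspace_pt <[t *m E]> (emb x v)).
  by split; rewrite ?addvSl ?subvf// dim_add_line.
split=> [[_ nA] v0 z vz|nsec].
  apply/eqP => zx; apply: nA; exists <[emb z v]>%VS => //.
  have [|k zxE] := @det2_eq0 _ t (z - x) t0.
    by rewrite det2Dr det2Nr zx subrr.
  apply: (add_line_eq (c := 1)); first exact: oner_neq0.
  by rewrite scale1r /emb opprD addrACA subrr addr0 -mulmxBl zxE -scalemxAl memvZ ?memv_line.
split=> //= -[p pA]; have [_ _] := hA pA; rewrite dimv0 => /dim1_line[q q0 pE].
rewrite {}pE in pA *; rewrite /pspace_pt => qx.
have /memv_addP[_ /vlineP[c ->] [_ /vlineP[d ->] qE]] : q \in (<[t *m E]> + <[emb x v]>)%VS.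
  by rewrite -qx memvE addvSr.
have qz : q = d *: emb x v + (c *: t) *m E by rewrite qE addrC -scalemxAl.
have qL : q \notin L.
  by apply/negP => /LE[z qzE]; move: pA; rewrite qzE; apply: notinA.
have d0 : d != 0.
  by apply: contraNneq qL => d0; rewrite qz d0 scale0r add0r EL.
have v0 : v != 0.
  apply: contraNneq qL => v0; rewrite qz v0 embx0 memvD ?memvZ ?EL//.
have := nsec v0 (x + (c / d) *: t); rewrite det2Dr det2Zr det2vv mulr0 addr0 eqxx.
suff vz : sec v (x + (c / d) *: t) by move=> /(_ vz).
rewrite /sec /= -(vlineZ _ d0) (_ : d *: _ = q)// qz /emb mulmxDl -!scalemxAl.
by rewrite !scalerDr scalerA [d * _]mulrC divfK// addrAC.
Qed.


Lemma det2_eq1 : exists x, det2 t x = 1.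
Proof.
have := det2_perp_gt0 t0 => pt; exists (- (det2 (perp t) t)^-1 *: perp t).
by rewrite det2Zr (det2C t) mulrNN mulVf// gt_eqF.
Qed.

Lemma center_pspace : pspace 0%VS L <[t *m E]>%VS.
Proof. by apply: pspace_line; [apply: contra_neq t0 => /E0|apply: EL]. Qed.

(** The image of [L] lies in the coimage, which is open, so [emb x0 v'] projects into it for small
    [v']. A point [x] of [sec v] with [m = det2 t x] too large would, scaled by [m^-1], share the
    value 1 of [x0] over such a small vector. *)
Lemma sec_bounded v : v != 0 -> exists M, forall x, sec v x -> `|det2 t x| <= M.
Proof.
move=> v0; case: hLA => _ _ _ /(_ _ center_pspace)/= [/open_subspaceP[V Vo VE] _].
have [x0 tx0] := det2_eq1.
have tx0n : det2 t x0 != 0 by rewrite tx0 oner_neq0.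
have inD z u : u != 0 \/ det2 t z != 0 ->
    [set x : 'rV[R]_4 | x \in fullv /\ x \notin <[t *m E]>%VS] (emb z u).
  by move=> h /=; rewrite memvf notin_center.
have V0 : V (emb x0 0).
  suff : (V `&` [set x : 'rV[R]_4 | x \in fullv /\ x \notin <[t *m E]>%VS]) (emb x0 0) by case.
  rewrite VE; split; last by apply: inD; right.
  by apply/coimageP; [right|rewrite eqxx].
have : nbhs (0 : 'rV[R]_2) (emb x0 @^-1` V).
  apply: open_nbhs_nbhs; split=> //.
  by apply: open_comp Vo => z _; apply: emb_continuousr.
move=> /nbhs_ballP[e /= e0 eV].
exists (`|v| / e) => x vx; rewrite leNgt; apply/negP => lt_m.
set m := det2 t x in lt_m.
have m0 : m != 0.
  by apply: contraTneq lt_m => ->; rewrite normr0 -leNgt divr_ge0// ltW.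
have v'0 : m^-1 *: v != 0 by rewrite scaler_eq0 negb_or invr_eq0 m0.
have : V (emb x0 (m^-1 *: v)).
  apply: eV; rewrite -ball_normE /= sub0r normrN normrZ normfV mulrC.
  by rewrite ltr_pdivrMr ?normr_gt0// mulrC -ltr_pdivrMr.
move=> Vm; have : (V `&` [set x : 'rV[R]_4 | x \in fullv /\ x \notin <[t *m E]>%VS])
    (emb x0 (m^-1 *: v)) by split=> //; apply: inD; left.
rewrite VE => -[/coimageP]; move=> /(_ (or_introl v'0) v'0 (m^-1 *: x)).
by rewrite secZ ?invr_eq0// => /(_ vx); rewrite det2Zr tx0 mulVf// eqxx.
Qed.

(* The hyperplane [H] disjoint from the coimage does not contain the image of L, so
   it is the graph of a linear [h]; [h v] is a value of [det2 t] on [sec v]. *)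
Lemma sec_affine : exists (x0 : 'rV[R]_2) (H : {vspace 'rV[R]_4}), det2 t x0 = 1 /\
  [/\ forall v, exists h, emb (h *: x0) v \in H,
    forall v h, v != 0 -> emb (h *: x0) v \in H ->
      exists2 x, sec v x & det2 t x = h &
    forall v v' h h' c, v != 0 -> v' != 0 -> c *: v + (1 - c) *: v' != 0 ->
      emb (h *: x0) v \in H -> emb (h' *: x0) v' \in H -> 0 <= c <= 1 ->
      (forall x, sec v x -> det2 t x != 1 + h) ->
      (forall x, sec v' x -> det2 t x != 1 + h') ->
      forall x, sec (c *: v + (1 - c) *: v') x ->
        det2 t x != 1 + (c * h + (1 - c) * h')].
Proof.
have [x0 tx0] := det2_eq1; exists x0.
case: hLA => _ _ _ /(_ _ center_pspace)/= [_ [H [[TH _ dH] CH [w [_ wH cvxS]]]]].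
exists H; split=> //; pose u := emb x0 0.
have tx0n : det2 t x0 != 0 by rewrite tx0 oner_neq0.
have inH z v : v != 0 \/ det2 t z != 0 -> emb z v \in H ->
    ~ coimage (pspace_pt <[t *m E]> (emb z v)).
  move=> h zvH zvC; suff : (coimage `&` pspace <[t *m E]> H) (pspace_pt <[t *m E]> (emb z v)).
    by rewrite [X in X _]CH.
  split=> //; split; rewrite ?addvSl ?dim_add_line ?notin_center//.
  by rewrite subv_add TH -memvE.
(* The image of [L] is in the coimage, hence off [H]: this makes [H] a graph. *)
have uH : u \notin H.
  apply/negP => /inH; apply; first by right.
  by apply/coimageP; [right|rewrite eqxx].
have embE h v : emb (h *: x0) v = h *: u + v *m Q.
  by rewrite /u embx0 /emb -scalemxAl.
have emb1E h v : emb ((1 + h) *: x0) v = u + emb (h *: x0) v.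
  by rewrite -[v in LHS]add0r scalerDl scale1r embD.
split=> [v|v h v0 vH|v v' h h' c v0 v'0 vv' vH v'H c01 nv nv' x].
- have [vH|vH] := boolP (v *m Q \in H).
    by exists 0; rewrite embE scale0r add0r.
  have [a a0 aH] := hyperplane_split (subvf H) dH (memvf u) uH (memvf (v *m Q)) vH.
  exists (- a); rewrite embE (_ : _ + _ = a *: (a^-1 *: (v *m Q) - u)) ?memvZ//.
  by rewrite scalerBr scalerA divff// scale1r scaleNr addrC.
- apply: contrapT => nx; apply: (inH _ _ (or_introl v0) vH).
  apply/coimageP; first by left.
  move=> _ z vz; apply: contra_not_neq nx => zh; exists z => //.
  by rewrite zh det2Zr tx0 mulr1.
(* A multiple of [u] lies in the chart [w + H], and so does the same multiple of [u] plus any vector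
   of [H]; this is the origin of [1 + h]. *)
have [a a0 aH] := hyperplane_split (subvf H) dH (memvf w) wH (memvf u) uH.
have inS z k : z != 0 -> emb (k *: x0) z \in H ->
    (forall x, sec z x -> det2 t x != 1 + k) ->
   [set x | x - w \in H /\ coimage (pspace_pt <[t *m E]> x)] (a^-1 *: emb ((1 + k) *: x0) z).
  move=> z0 zH nz; split.
    by rewrite emb1E scalerDr addrAC memvD// memvZ.
  rewrite pspace_ptZ ?invr_neq0//; apply/coimageP; first by left.
  by move=> _ y /nz; rewrite det2Zr tx0 mulr1.
have [_] := convex_set_comb cvxS (inS _ _ v0 vH nv) (inS _ _ v'0 v'H nv') c01.
set k := c * h + (1 - c) * h'.
rewrite (_ : _ + _ = a^-1 *: emb ((1 + k) *: x0) (c *: v + (1 - c) *: v')).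
  rewrite pspace_ptZ ?invr_neq0// => /coimageP; move=> /(_ (or_introl vv') vv' x) h1 h2.
  by have := h1 h2; rewrite det2Zr tx0 mulr1.
rewrite !scalerA (mulrC c) (mulrC (1 - c)) -!scalerA -scalerDr; congr (_ *: _).
rewrite -!embZ -embD; congr (emb _ _); rewrite !scalerA -scalerDl; congr (_ *: _).
by rewrite /k; ring.
Qed.

Lemma sec_neq0 v : v != 0 -> sec v !=set0.
Proof.
have [x0 [H [_ [hE hA' _]]]] := sec_affine; move=> v0.
by have [h /hA'-/(_ v0)[x vx _]] := hE v; exists x.
Qed.

(* If [det2 t] is below [a] on [sec v] then [v / p] lies in the coimage as soon as
   [p > a - h v]; convexity of the coimage makes this bound subadditive. *)
Lemma sec_subadd v v' a b : v != 0 -> v' != 0 -> v + v' != 0 ->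
  (forall x, sec v x -> det2 t x <= a) -> (forall x, sec v' x -> det2 t x <= b) ->
  forall x, sec (v + v') x -> det2 t x <= a + b.
Proof.
move=> v0 v'0 vv'0 va v'b x vx; rewrite leNgt; apply/negP => lt_abx.
have [x0 [H [_ [hE hA' cvx]]]] := sec_affine.
have [h hH] := hE v; have [h' h'H] := hE v'.
have ha : h <= a by have [y /va + <-] := hA' _ _ v0 hH.
have h'b : h' <= b by have [y /v'b + <-] := hA' _ _ v'0 h'H.
(* Half of the excess: [p] and [q] become positive, and [p + q] equals [det2 t x - (h + h')]. *)
pose e := (det2 t x - (a + b)) / 2.
have e0 : 0 < e by rewrite divr_gt0// subr_gt0.
pose p := a - h + e; pose q := b - h' + e.
have p0 : 0 < p by rewrite /p; lra.
have q0 : 0 < q by rewrite /q; lra.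
have scale z k r y : 0 < r -> (forall x, sec z x -> det2 t x <= k + r - e) ->
    sec (r^-1 *: z) y -> det2 t y != 1 + k / r.
  move=> r0 zk zy; have rn0 : r != 0 by rewrite gt_eqF.
  have /zk : sec z (r *: y).
    by rewrite -(@secZ r^-1) ?invr_eq0// scalerA mulVf// scale1r.
  rewrite det2Zr => h1; apply: contraTneq e0 => ye; rewrite -leNgt.
  by move: h1; rewrite ye mulrDr mulr1 mulrCA divff// mulr1; lra.
have pn0 : p != 0 by rewrite gt_eqF.
have qn0 : q != 0 by rewrite gt_eqF.
have pq0 : 0 < p + q by rewrite addr_gt0.
have pqn0 : p + q != 0 by rewrite gt_eqF.
have cpE : p / (p + q) / p = (p + q)^-1 by field; rewrite ?pqn0 ?pn0.
have cE : 1 - p / (p + q) = q / (p + q) by field; rewrite ?pqn0.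
have cqE : q / (p + q) / q = (p + q)^-1 by field; rewrite ?pqn0 ?qn0.
have embH k z r : r != 0 -> emb (k *: x0) z \in H -> emb ((k / r) *: x0) (r^-1 *: z) \in H.
  by move=> r0 kH; rewrite mulrC -scalerA embZ memvZ.
have nzZ (z : 'rV[R]_2) r : r != 0 -> z != 0 -> r^-1 *: z != 0.
  by move=> r0 z0; rewrite scaler_eq0 negb_or invr_eq0 r0.
have := cvx _ _ _ _ (p / (p + q)) (nzZ _ _ pn0 v0) (nzZ _ _ qn0 v'0) _
  (embH _ _ _ pn0 hH) (embH _ _ _ qn0 h'H).
rewrite cE !scalerA cpE cqE -scalerDr => /(_ (nzZ _ _ pqn0 vv'0)).
have c01 : 0 <= p / (p + q) <= 1 by apply: frac01 => //; rewrite ltW// mulr_gt0.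
have sv y : sec (p^-1 *: v) y -> det2 t y != 1 + h / p.
  by apply: scale => // z /va; rewrite /p; lra.
have sv' y : sec (q^-1 *: v') y -> det2 t y != 1 + h' / q.
  by apply: scale => // z /v'b; rewrite /q; lra.
move=> /(_ c01 sv sv' ((p + q)^-1 *: x)); rewrite secZ ?invr_eq0// => /(_ vx)/eqP; apply.
rewrite det2Zr !mulrA; apply: (mulfI pqn0); rewrite mulrA divff// mul1r.
have {1}-> : det2 t x = p + q + (h + h') by rewrite /p /q /e; field.
by field; rewrite ?pqn0 ?pn0 ?qn0.
Qed.


End FixedPoint.

(** * Support functions and the line contained in A *)

Definition supp t v := sup [set det2 t x | x in sec v].

Lemma sec_nonempty v : v != 0 -> sec v !=set0.
Proof.
apply: (@sec_neq0 (const_mx 1)); apply/eqP => /matrixP/(_ 0 0).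
by rewrite !mxE => /eqP; rewrite oner_eq0.
Qed.

Lemma sec_bound t v : v != 0 -> exists M, forall x, sec v x -> `|det2 t x| <= M.
Proof.
have [->|t0] := eqVneq t 0; last exact: sec_bounded.
by exists 0 => x _; rewrite -(scale0r 0) det2Zl mul0r normr0.
Qed.

Lemma supp_ub t v x : sec v x -> det2 t x <= supp t v.
Proof.
move=> vx; apply: ub_le_sup; last by exists x.
have [v0|v0] := eqVneq v 0; first by move: vx; rewrite v0 => /sec0.
have [M hM] := sec_bound t v0; exists M => _ [y /hM + <-].
by apply: le_trans; apply: ler_norm.
Qed.

Lemma supp_le t v M : v != 0 -> (forall x, sec v x -> det2 t x <= M) -> supp t v <= M.
Proof.
move=> /sec_nonempty[x vx] h; apply: ge_sup; first by exists (det2 t x), x.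
by move=> _ [y /h + <-].
Qed.

Lemma suppx0 t : supp t 0 = 0.
Proof.
rewrite /supp (_ : sec 0 = set0) ?image_set0 ?sup0//.
by apply/seteqP; split=> // x /sec0.
Qed.

Lemma supp_bisublinear : bisublinear supp.
Proof.
have nz c (v : 'rV[R]_2) : c != 0 -> v != 0 -> c *: v != 0.
  by move=> c0 v0; rewrite scaler_eq0 negb_or c0.
have supp0x v : supp 0 v = 0.
  have [->|v0] := eqVneq v 0; first exact: suppx0.
  have d0 x : det2 0 x = 0 :> R by rewrite -(scale0r 0) det2Zl mul0r.
  have [x vx] := sec_nonempty v0.
  apply/eqP; rewrite eq_le supp_le//= => [|y _]; last by rewrite d0.
  by have := supp_ub 0 vx; rewrite d0.
have suppZl c t v : 0 < c -> supp (c *: t) v <= c * supp t v.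
  move=> c0; have [->|v0] := eqVneq v 0; first by rewrite !suppx0 mulr0.
  by apply: supp_le => // x vx; rewrite det2Zl ler_pM2l// supp_ub.
have suppZr c t v : 0 < c -> supp t (c *: v) <= c * supp t v.
  move=> c0; have [->|v0] := eqVneq v 0; first by rewrite scaler0 !suppx0 mulr0.
  apply: supp_le => [|x]; first by rewrite nz// gt_eqF.
  rewrite -[x](scalerKV (lt0r_neq0 c0)) secZ ?gt_eqF// => vx.
  by rewrite det2Zr ler_pM2l// supp_ub.
have suppNN t v : supp (- t) (- v) <= supp t v.
  have [->|v0] := eqVneq v 0; first by rewrite oppr0 !suppx0.
  apply: supp_le => [|x]; first by rewrite oppr_eq0.
  move=> vx; have /(supp_ub t) : sec v (- x) by apply/secN; rewrite opprK.
  by rewrite det2Nl det2Nr.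
split.
- move=> t t' v; have [->|v0] := eqVneq v 0; first by rewrite !suppx0 addr0.
  by apply: supp_le => // x vx; rewrite det2Dl lerD// supp_ub.
- move=> t v v'; have [->|t0] := eqVneq t 0; first by rewrite !supp0x addr0.
  have [->|v0] := eqVneq v 0; first by rewrite suppx0 !add0r.
  have [->|v'0] := eqVneq v' 0; first by rewrite suppx0 !addr0.
  (* If the sum is zero, [sec v'] is the opposite of [sec v], and the two suprema have a nonnegative
     sum. *)
  have [vv'0|vv'0] := eqVneq (v + v') 0.
    rewrite vv'0 suppx0; have [x vx] := sec_nonempty v0.
    have /(supp_ub t) : sec v' (- x).
      by rewrite -(addr0_eq vv'0); apply/secN.
    by have := supp_ub t vx; rewrite det2Nr; lra.
  by apply: supp_le => // x; apply: sec_subadd => // y vy; apply: supp_ub.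
- move=> c t v; rewrite le_eqVlt => /predU1P[<-|c0]; first by rewrite scale0r supp0x mul0r.
  apply/eqP; rewrite eq_le suppZl//= -ler_pdivlMl//.
  by rewrite -{1}[t](scalerK (lt0r_neq0 c0)) suppZl// invr_gt0.
- move=> c t v; rewrite le_eqVlt => /predU1P[<-|c0]; first by rewrite scale0r suppx0 mul0r.
  apply/eqP; rewrite eq_le suppZr//= -ler_pdivlMl//.
  by rewrite -{1}[v](scalerK (lt0r_neq0 c0)) suppZr// invr_gt0.
- move=> t v; apply/eqP; rewrite eq_le suppNN /=.
  by rewrite -{1}[t]opprK -{1}[v]opprK suppNN.
Qed.

(** The matrix [X] is chosen so that [det2 t (v *m X)] is the bilinear minorant of [supp]. Hence no
    functional separates [v *m X] from the closed convex set [sec v]. *)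
Lemma linear_section : exists X : 'M[R]_2, forall v, v != 0 -> sec v (v *m X).
Proof.
have [b hb] := bilinear_minorant supp_bisublinear.
pose X := \matrix_(j < 2, k < 2) (if k == 0 then - b 1 j else b 0 j).
have ord2E : lift ord0 ord0 = 1 :> 'I_2 by apply: val_inj.
have detE t v : det2 t (v *m X) = \sum_i \sum_j t 0 i * v 0 j * b i j.
  rewrite /det2 !mxE !big_ord_recl !big_ord0 !ord2E !mxE /=; ring.
exists X => v v0; apply: contrapT => vX.
have [t [M [hM ltM]]] := separation (sec_nonempty v0) (sec_closed v0)
  (fun t => sec_bound t v0) (@sec_convex v) vX.
have := hb t v; rewrite -detE leNgt => /negP; apply.
by apply: le_lt_trans ltM; apply: supp_le.
Qed.

(** The line is the graph of the map given by [X], spanned by the rows of [W]. *)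
Lemma contains_line : exists M : {vspace 'rV[R]_4}, \dim M = 2%N /\ pspace 0%VS M `<=` A.
Proof.
have [X hX] := linear_section; pose W := X *m E + Q.
have embW v : emb (v *m X) v = v *m W by rewrite /emb /W mulmxDr mulmxA.
have ord2E : lift ord0 ord0 = 1 :> 'I_2 by apply: val_inj.
have comb a c : a *: row 0 W + c *: row 1 W = (a *: delta_mx 0 0 + c *: delta_mx 0 1) *m W.
  by rewrite mulmxDl -!scalemxAl -!rowE.
have W0 (v : 'rV_2) : v *m W = 0 -> v = 0.
  by rewrite -embW => vW; apply: contra_eq vW; apply: emb_neq0.
pose r0 := row 0 W; pose r1 := row 1 W; exists (<[r0]> + <[r1]>)%VS; split.
  rewrite dim_add_line ?dim_vline.
    rewrite (_ : r0 != 0)// /r0 rowE; apply/eqP => /W0/matrixP/(_ 0 0).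
    by rewrite !mxE => /eqP; rewrite oner_eq0.
  apply/vlineP => -[k /eqP]; rewrite -subr_eq0 addrC -scaleNr -[r1]scale1r comb.
  move=> /eqP/W0/matrixP/(_ 0 1); rewrite !mxE /= mulr0 add0r mulr1 => /eqP.
  by rewrite oner_eq0.
move=> p [_ pM]; rewrite dimv0 => /dim1_line[q q0 pE]; rewrite {p}pE -memvE in pM *.
have /memv_addP[_ /vlineP[a ->] [_ /vlineP[c ->] qE]] := pM.
rewrite comb -embW in qE; rewrite qE; apply: hX.
by apply: contraNneq q0 => v0; rewrite qE v0 mul0mx embx0 mul0mx.
Qed.

End Sections.

Theorem theorem1 (R : realType) (L : {vspace 'rV[R]_4})
    (A : set {vspace 'rV[R]_4})
    (hL : \dim L = 2%N)
    (hA : A `<=` pspace 0%VS fullv)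
    (hLA : L_convex_concave L A) :
  exists M : {vspace 'rV[R]_4}, \dim M = 2%N /\ pspace 0%VS M `<=` A.
Proof.
have [E [Q [EL LE E0 QL]]] := vspace2_coord hL.
exact: (contains_line hL hA hLA EL LE E0 QL).
Qed.
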